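(* Let $q>2$ be a fixed integer. For every nonnegative integer $d$ there exists a constant $C_d>0$ (depending only on $d$ and $q$) such that for every $t\in[0,\frac{q-1}{q}]$ and all sequences $(n_j)_j$, $(r_j)_j$ of nonnegative integers with $n_j\ge d$, $n_j \geq 1$, $\lim_{j\to\infty}n_j=\infty$ and $\lim_{j\to\infty}r_j/n_j=t$, we have $$\limsup_{j\to\infty}E^{((q-1)r_j)}(n_j)\le C_d\cdot\varphi_q(t),$$ and, if $d(d+1)\cdot\varphi_q(t)\le 1/2$, also $$\limsup_{j\to\infty}E_{((q-1)r_j)}(n_j)\le 2\,C_d\cdot\varphi_q(t),$$ where $$\varphi_q(t)=\frac{q-1}{q}-\Big(\frac{q-2}{q}\,t+\frac{2}{q}\sqrt{(q-1)t(1-t)}\Big).$$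
   Context: Let $Q^n=\{0,1,\dots,q-1\}^n\subseteq\mathbb{R}^n$ (the $q$-ary cube), and let $\mu$ be the uniform probability measure on $Q^n$. For $f\in\mathbb{R}[x_1,\dots,x_n]$ put $f_{\min}=\min_{x\in Q^n}f(x)$ and $\|f\|_\infty=\max_{x\in Q^n}|f(x)|$. $\mathbb{R}[x]_m$ denotes the polynomials of degree at most $m$. $\Sigma_r$ denotes the set of finite sums $\sum_i p_i^2$ with $p_i\in\mathbb{R}[x]_r$. Define $$f_{(r)}:=\sup\{\lambda\in\mathbb{R}:\exists s\in\Sigma_r,\ f(x)-\lambda=s(x)\ \forall x\in Q^n\},$$ $$f^{(r)}:=\inf_{s\in\Sigma_r}\Big\{\int_{Q^n}fs\,d\mu:\int_{Q^n}s\,d\mu=1\Big\}.$$ For $n\ge d$ and $r\in\mathbb{N}$ set $$E_{(r)}(n):=\sup_{f\in\mathbb{R}[x]_{(q-1)d}}\{f_{\min}-f_{(r)}:\|f\|_\infty=1\},\qquad E^{(r)}(n):=\sup_{f\in\mathbb{R}[x]_{(q-1)d}}\{f^{(r)}-f_{\min}:\|f\|_\infty=1\}.$$ (Values in $[0,+\infty]$; $f_{(r)}=-\infty$ if no feasible $\lambda$ exists.) *)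

(* Defs.v *)
From HB Require Import structures.
From mathcomp Require Import all_boot all_order all_algebra.
From mathcomp Require Import all_classical all_reals all_analysis.
(* The notations of [mpoly] clash with those of MathComp-Analysis. *)
From mathcomp Require mpoly.
Import (coercions, canonicals) mpoly.
Import Order.TTheory GRing.Theory Num.Theory.
Import numFieldNormedType.Exports.

Set Implicit Arguments.
Unset Strict Implicit.
Unset Printing Implicit Defensive.

Local Open Scope classical_set_scope.
Local Open Scope ring_scope.

Notation qcube q n := {ffun 'I_n -> 'I_q}.

Notation rpoly R n := (mpoly.mpoly n R).

Definition cube_point (R : realType) (q n : nat) (x : qcube q n) : 'I_n -> R :=
  fun i => (x i)%:R.

Definition evalQ (R : realType) (q n : nat) (f : rpoly R n) (x : qcube q n) : R :=
  mpoly.meval (@cube_point R q n x) f.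

(* [mpoly.msize f] is the total degree of [f] plus one, and [0] for [f = 0]. *)
Definition polys_le (R : realType) (n m : nat) : set (rpoly R n) :=
  [set f | (mpoly.msize f <= m.+1)%N].

Definition sos (R : realType) (n r : nat) : set (rpoly R n) :=
  [set s | exists ps : seq (rpoly R n),
     (forall p, p \in ps -> polys_le r p) /\ s = \sum_(p <- ps) p ^+ 2].

(* The integral over the cube with respect to the uniform probability measure,
   which gives mass [q ^ - n] to each of its points. *)
Definition intQ (R : realType) (q n : nat) (g : qcube q n -> R) : R :=
  \sum_(x : qcube q n) #|{: qcube q n}|%:R^-1 * g x.

(* The cube is nonempty as soon as [0 < q], so that the neutral element [+oo]
   is never the value of this minimum. *)
Definition fminQ (R : realType) (q n : nat) (f : rpoly R n) : \bar R :=
  \big[Order.min/+oo%E]_(x : qcube q n) (evalQ f x)%:E.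

Definition supnormQ (R : realType) (q n : nat) (f : rpoly R n) : R :=
  \big[Order.max/0]_(x : qcube q n) `|evalQ f x|.

Definition lower_bound (R : realType) (q n r : nat) (f : rpoly R n) : \bar R :=
  ereal_sup [set l%:E | l in [set l : R | exists2 s : rpoly R n, sos r s &
    forall x : qcube q n, evalQ f x - l = evalQ s x]].

Definition upper_bound (R : realType) (q n r : nat) (f : rpoly R n) : \bar R :=
  ereal_inf [set (@intQ R q n (fun x => evalQ f x * evalQ s x))%:E
    | s in [set s : rpoly R n | sos r s /\ @intQ R q n (evalQ s) = 1]].

Definition lower_error (R : realType) (q d r n : nat) : \bar R :=
  ereal_sup [set (fminQ q f - lower_bound q r f)%E
    | f in [set f : rpoly R n | polys_le ((q - 1) * d) f /\ supnormQ q f = 1]].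

Definition upper_error (R : realType) (q d r n : nat) : \bar R :=
  ereal_sup [set (upper_bound q r f - fminQ q f)%E
    | f in [set f : rpoly R n | polys_le ((q - 1) * d) f /\ supnormQ q f = 1]].

Definition phi (R : realType) (q : nat) (t : R) : R :=
  (q%:R - 1) / q%:R -
  ((q%:R - 2) / q%:R * t +
   2 / q%:R * Num.sqrt ((q%:R - 1) * t * (1 - t))).

(* Main.v *)
(* Fix f of degree at most (q-1)d and put D = (q-1)d + 1, so that f is a
   combination of functions of at most D coordinates. If a proportion of the
   coordinates of x is resampled by a Markov kernel on the alphabet, then the
   mean value of f at the new point, averaged over all sets J of m kept
   coordinates, is a polynomial of degree at most D in m, bounded by sup|f| at
   m = 0, ..., n, whose value at m = n is f(x). Two choices of the Markov kernel
   are used.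
   - Changing all letters outside J gives the averages of f over the spheres
     around x, so that |K f - f| is at most a constant times the mean of
     dist(x, y) / n under K(x, y), for any probability kernel K depending on the
     distance only. Squares of combinations of the Krawtchouk polynomials of
     degrees r+1-M, ..., r with equal weights in the orthonormal basis give such
     a K that is a sum of squares of degree (q-1)r and for which this mean tends
     to phi(t) + O(1/M). The kernel at a minimizer of f bounds the upper error.
   - Uniform letters outside J give functions of m coordinates, which are sums of
     squares of degree (q-1)m once they are nonnegative. Extrapolating the
     polynomial from m <= r to m = n shows that g + C sup|g| is a sum of squares
     of degree (q-1)r for every combination g of functions of D coordinates, with
     C bounded as long as r/n stays away from 0.
   For the lower error write f - min f + C sup|g| as the sum of K(f - min f) and
   g + C sup|g|, with g = f - K f. The condition d(d+1) phi(t) <= 1/2 is only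
   used to bound t away from 0 when d > 0. *)
Require Import Defs.
From mathcomp Require Import all_boot all_order all_algebra.
From mathcomp Require Import all_classical all_reals all_analysis.
From mathcomp Require Import ring lra zify.
From mathcomp Require mpoly.
Import (coercions, canonicals) mpoly.
Import Order.TTheory GRing.Theory Num.Theory.
Import numFieldNormedType.Exports.
Set Implicit Arguments.
Unset Strict Implicit.
Unset Printing Implicit Defensive.
Local Open Scope ring_scope.

(** * Lagrange interpolation on grids *)

Lemma horner_lagrange (F : fieldType) (D : nat) (x : nat -> F)
    (p : {poly F}) (z : F) : injective x -> (size p <= D.+1)%N ->
  p.[z] = \sum_(i < D.+1)
    p.[x i] * \prod_(j < D.+1 | j != i) ((z - x j) / (x i - x j)).
Proof.
move=> x_inj szp; rewrite {1}(qpoly.lagrange_gen (ltn0Sn D) x_inj szp).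
rewrite horner_sum; apply: eq_bigr => i _.
rewrite hornerM hornerC qpoly.lagrangeE //= hornerM hornerC.
rewrite !horner_prod prodf_div; congr (_ * _); rewrite mulrC.
by congr (_ / _); apply: eq_bigr => j _; rewrite hornerXsubC.
Qed.

Lemma card_ordC1 (D : nat) (i : 'I_D.+1) : #|[pred j | j != i]| = D.
Proof. by rewrite (@eq_card _ _ (predC1 i)) // cardC1 card_ord. Qed.

Section BoundedOnGrid.

Variable R : realType.
Implicit Types (D n m k r s : nat) (P : {poly R}) (B : R).

Lemma ler_dist_nodes s (a b : nat) :
  (0 < s)%N -> a != b -> s%:R <= `|a%:R * s%:R - b%:R * s%:R| :> R.
Proof.
move=> s0; rewrite -mulrBl normrM normr_nat neq_ltn => ab.
apply: ler_peMl => //; case/orP: ab => ltab; first rewrite distrC.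
  by rewrite -natrB ?(ltnW ltab) // normr_nat ler1n subn_gt0.
by rewrite -natrB ?(ltnW ltab) // normr_nat ler1n subn_gt0.
Qed.

Lemma nodes_inj s : (0 < s)%N -> injective (fun i => i%:R * s%:R : R).
Proof.
move=> s0 i j /(mulIf _) => /(_ _)/eqP; rewrite eqr_nat pnatr_eq0 -lt0n s0.
by move=> /(_ isT)/eqP.
Qed.

(** As [r %/ D] is at least 1, rounding down loses at most a factor 2, the 2 in the factors
    [2 * D%:R] below. *)
Lemma leq_double_mesh D r : (0 < D <= r)%N -> (r <= 2 * D * (r %/ D))%N.
Proof.
case/andP=> D0 Dr; have s1 : (1 <= r %/ D)%N by rewrite divn_gt0.
have := ltn_ceil r D0; nia.
Qed.

Lemma mesh_ratio D n r : (0 < D <= r)%N ->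
  n%:R / (r %/ D)%:R <= 2 * D%:R * n%:R / r%:R :> R.
Proof.
move=> /andP[D0 Dr]; have := @leq_double_mesh D r; rewrite D0 Dr => /(_ isT).
have s1 : (0 < r %/ D)%N by rewrite divn_gt0.
have r1 : (0 < r)%N by apply: leq_trans Dr.
rewrite -(ler_nat R) !natrM => le2.
rewrite ler_pdivrMr ?ltr0n // mulrAC ler_pdivlMr ?ltr0n //.
have -> : 2 * D%:R * n%:R * (r %/ D)%:R = n%:R * (2 * D%:R * (r %/ D)%:R) :> R.
  by ring.
by rewrite ler_wpM2l.
Qed.

(** The [c i] are the Lagrange weights at n for the nodes 0, s, ..., D s with s = [r %/ D], all at
    most r. Each of the D factors of a weight is at most n / s in absolute value. *)
Lemma grid_extrapolation D n r : (0 < D <= r)%N -> (r <= n)%N ->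
  exists c : 'I_D.+1 -> R,
    \sum_i `|c i| <= D.+1%:R * (2 * D%:R * n%:R / r%:R) ^+ D /\
    forall P, (size P <= D.+1)%N ->
      P.[n%:R] = \sum_i c i * P.[(i * (r %/ D))%:R].
Proof.
move=> Dr rn; have [D0 Dler] := andP Dr; set s := (r %/ D)%N.
have s0 : (0 < s)%N by rewrite divn_gt0.
exists (fun i => \prod_(j < D.+1 | j != i)
   ((n%:R - j%:R * s%:R) / (i%:R * s%:R - j%:R * s%:R))); split; last first.
  move=> P szP; rewrite (horner_lagrange n%:R (nodes_inj s0) szP).
  by apply: eq_bigr => i _; rewrite mulrC natrM.
have bound_i (i : 'I_D.+1) :
  `|\prod_(j < D.+1 | j != i)
     ((n%:R - j%:R * s%:R) / (i%:R * s%:R - j%:R * s%:R))| <=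
  (2 * D%:R * n%:R / r%:R) ^+ D :> R.
  rewrite normr_prod -[X in _ ^+ X](card_ordC1 i) -prodr_const.
  apply: ler_prod => j /= ji; rewrite normr_ge0 /=.
  apply: le_trans (mesh_ratio n Dr); rewrite normf_div.
  have js_n : (j * s <= n)%N.
    rewrite (leq_trans _ rn) // (leq_trans _ (leq_divM r D)) //.
    by rewrite mulnC leq_mul2l -ltnS ltn_ord orbT.
  apply: ler_pM; rewrite ?invr_ge0 //.
    by rewrite -natrM -natrB // normr_nat ler_nat leq_subr.
  by rewrite lef_pV2 ?posrE ?ltr0n // ?ler_dist_nodes 1?eq_sym //;
     apply: lt_le_trans (ler_dist_nodes s0 _); rewrite ?ltr0n 1?eq_sym.
apply: (@le_trans _ _
  (\sum_(i < D.+1) (2 * D%:R * n%:R / r%:R) ^+ D)).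
  by apply: ler_sum => i _; apply: bound_i.
by rewrite sumr_const card_ord -[leLHS]mulr_natl.
Qed.

(* Interpolating at the nodes [n - j (n %/ D)], whose first one is [n], makes
   every remaining Lagrange coefficient at [n - k] proportional to [k]. *)
Lemma grid_modulus D n k P B : (0 < D <= n)%N -> (k <= n)%N ->
  (size P <= D.+1)%N -> (forall m, (m <= n)%N -> `|P.[m%:R]| <= B) ->
  `|P.[(n - k)%:R] - P.[n%:R]| <=
    2 * D.+1%:R * (2 * D%:R) ^+ D * B * (k%:R / n%:R).
Proof.
move=> Dn kn szP PB; have [D0 Dlen] := andP Dn; set s := (n %/ D)%N.
have n0 : (0 < n)%N by apply: leq_trans Dlen.
have s0 : (0 < s)%N by rewrite divn_gt0.
have ratio : n%:R / s%:R <= 2 * D%:R :> R.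
  by apply: le_trans (mesh_ratio n Dn) _; rewrite mulfK // pnatr_eq0 -lt0n.
have inj : injective (fun j => n%:R - j%:R * s%:R : R).
  by move=> i j /addrI/oppr_inj/(nodes_inj s0).
have B0 : 0 <= B by apply: le_trans (PB 0%N _).
(* Q vanishes at n, the node of index 0. Every other weight contains the factor of that node, whose
   numerator has absolute value k. *)
pose Q := P - P.[n%:R]%:P.
have szQ : (size Q <= D.+1)%N.
  rewrite (leq_trans (size_polyD _ _)) // geq_max szP size_polyN.
  exact: leq_trans (size_polyC_leq1 _) _.
have -> : P.[(n - k)%:R] - P.[n%:R] = Q.[(n - k)%:R] by rewrite !hornerE.
rewrite (horner_lagrange _ inj szQ).
apply: le_trans (ler_norm_sum _ _ _) _.
have -> : 2 * D.+1%:R * (2 * D%:R) ^+ D * B * (k%:R / n%:R) =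
   \sum_(i < D.+1) 2 * B * ((2 * D%:R) ^+ D * (k%:R / n%:R)) :> R.
  by rewrite sumr_const card_ord -mulr_natl; ring.
apply: ler_sum => i _.
have is_n (l : 'I_D.+1) : (l * s <= n)%N.
  rewrite (leq_trans _ (leq_divM n D)) //.
  by rewrite mulnC leq_mul2l -ltnS ltn_ord orbT.
have [->|i0] := eqVneq i ord0.
  rewrite /= mul0r subr0 !hornerE subrr mul0r normr0.
  by rewrite !(mulr_ge0, exprn_ge0, invr_ge0).
rewrite normrM; apply: ler_pM => //.
  rewrite !hornerE -natrM -natrB // (le_trans (ler_normB _ _)) // mulr2n mulrDl.
  by rewrite mul1r lerD // PB // leq_subr.
rewrite normr_prod (bigD1 ord0) 1?eq_sym //= mul0r subr0.
have sz (l : 'I_D.+1) : l != i ->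
    s%:R <= `|n%:R - i%:R * s%:R - (n%:R - l%:R * s%:R)| :> R.
  move=> li; have -> : n%:R - i%:R * s%:R - (n%:R - l%:R * s%:R) =
    l%:R * s%:R - i%:R * s%:R :> R by ring.
  exact: ler_dist_nodes.
have -> : (2 * D%:R) ^+ D * (k%:R / n%:R) =
    (k%:R * (2 * D%:R) / n%:R) * (2 * D%:R) ^+ D.-1 :> R.
  have -> : (2 * D%:R) ^+ D = 2 * D%:R * (2 * D%:R) ^+ D.-1 :> R.
    by rewrite -exprS prednK.
  by ring.
have s0R : 0 < s%:R :> R by rewrite ltr0n.
apply: ler_pM; rewrite ?prodr_ge0 //.
  rewrite normf_div distrC natrB // opprB addrCA subrr addr0 normr_nat.
  apply: (@le_trans _ _ (k%:R / s%:R)).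
    have szi : s%:R <= `|n%:R - i%:R * s%:R - n%:R| :> R.
      by have := sz ord0; rewrite mul0r subr0; apply; rewrite eq_sym.
    by rewrite ler_wpM2l // lef_pV2 ?posrE // (lt_le_trans s0R szi).
  rewrite -mulrA ler_wpM2l // ler_pdivlMr ?ltr0n //.
  by rewrite mulrC.
have cardD : #|[pred l : 'I_D.+1 | (l != i) && (l != ord0)]| = D.-1.
  have := card_ordC1 i; rewrite (cardD1 ord0) inE /= eq_sym i0 add1n.
  move=> /(congr1 predn) /= cardE; apply: etrans cardE.
  by apply: eq_card => l; rewrite !inE andbC.
rewrite -cardD -prodr_const; apply: ler_prod => l /= /andP[li l0].
rewrite normr_ge0 /= (le_trans _ ratio) // normf_div.
apply: ler_pM; rewrite ?invr_ge0 //; last first.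
  by rewrite lef_pV2 ?posrE ?sz //; apply: lt_le_trans (sz _ li).
have := is_n l; rewrite -(ler_nat R) natrM => ls_n.
have kn' : k%:R <= n%:R :> R by rewrite ler_nat.
rewrite natrB // ler_norml.
have ? : 0 <= l%:R * s%:R :> R by rewrite mulr_ge0.
have ? : 0 <= k%:R :> R by [].
by apply/andP; split; lra.
Qed.

End BoundedOnGrid.

(** * Averages over subsets of given size *)

Section SubsetAverages.

Variables (R : realType) (n : nat).
Implicit Types (J S U : {set 'I_n}) (m : nat).

Lemma card_supersets U m : (#|U| <= m)%N ->
  #|[set J : {set 'I_n} | (U \subset J) && (#|J| == m)]| =
  'C(n - #|U|, m - #|U|).
Proof.
move=> Um; have -> : (n - #|U| = #|~: U|)%N.
  by rewrite (cardsCs (~: U)) finset.setCK card_ord.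
rewrite -cards_draws.
pose A := finset (fun K : {set 'I_n} => (K \subset ~: U) && (#|K| == m - #|U|)%N).
have injU : {in A &, injective (fun K : {set 'I_n} => K :|: U)}.
  move=> K L; rewrite !inE => /andP[KU _] /andP[LU _] KL; apply/finset.setP => i.
  move/finset.setP/(_ i): KL; rewrite !inE.
  have := fintype.subsetP KU i; have := fintype.subsetP LU i.
  by rewrite !inE; case: (i \in U); case: (i \in K); case: (i \in L) => // _;
    move=> /(_ isT).
rewrite -/A -(card_in_imset injU); apply: eq_card => J; rewrite !inE.
apply/andP/imsetP => [[UJ /eqP Jm]|[K]].
  exists (J :\: U); last first.
    by rewrite finset.setUC -{1}(finset.setIidPr UJ) finset.setID.
  by rewrite inE cardsD (finset.setIidPr UJ) Jm eqxx andbT finset.subsetDr.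
rewrite inE => /andP[KU /eqP Km] ->; split; first exact: finset.subsetUr.
rewrite cardsU Km; have -> : K :&: U = finset.set0.
  by apply/eqP; rewrite finset.setI_eq0 finset.disjoints_subset.
by rewrite cards0 subn0 subnK.
Qed.

(** A random m-subset of k points contains a given u-subset with probability [m ^_ u / k ^_ u], a
    polynomial of degree u in m. *)
Lemma bin_sub_ffact (u m k : nat) : (u <= m <= k)%N ->
  ('C(k - u, m - u) * k ^_ u = 'C(k, m) * m ^_ u)%N.
Proof.
case/andP=> um mk; have uk := leq_trans um mk.
have := bin_fact mk; rewrite -(ffact_fact um) -(ffact_fact uk).
have mu : (m - u <= k - u)%N by rewrite leq_sub2r.
rewrite -(bin_fact mu) (_ : (k - u - (m - u) = k - m)%N); last by lia.
set f1 := (m - u)`!; set f2 := (k - m)`!.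
have f0 : (0 < f1 * f2)%N by rewrite muln_gt0 !fact_gt0.
move=> E; apply/eqP; rewrite -(eqn_pmul2r f0); apply/eqP.
by move: E; rewrite -!mulnA (mulnCA (k ^_ u)) => <-.
Qed.

Definition ffact_poly (u : nat) : {poly R} := \prod_(j < u) ('X - j%:R%:P).

Lemma size_ffact_poly u : size (ffact_poly u) = u.+1.
Proof.
rewrite /ffact_poly size_prod_XsubC.
by rewrite /index_enum -enumT size_enum_ord.
Qed.

Lemma horner_ffact_poly u m : (ffact_poly u).[m%:R] = (m ^_ u)%:R.
Proof.
rewrite /ffact_poly horner_prod; elim: u => [|u IHu].
  by rewrite big_ord0.
rewrite big_ord_recr /= IHu ffactnSr natrM !hornerE.
have [um|mu] := leqP u m; first by rewrite natrB.
by rewrite ffact_small // !mul0r.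
Qed.

Lemma sum_draws_poly S (G H : 'I_n -> R) :
  exists2 P : {poly R}, (size P <= #|S|.+1)%N & forall m, (m <= n)%N ->
    \sum_(J : {set 'I_n} | #|J| == m)
      \prod_(i in S) (if i \in J then G i else H i) = 'C(n, m)%:R * P.[m%:R].
Proof.
pose c U : R := (\prod_(i in U) (G i - H i)) * \prod_(i in S :\: U) H i.
have nff U : (n ^_ #|U|)%:R != 0 :> R.
  by rewrite pnatr_eq0 -lt0n ffact_gt0 -[X in (_ <= X)%N]card_ord max_card.
exists (\sum_(U : {set 'I_n} | U \subset S)
          (c U / (n ^_ #|U|)%:R) *: ffact_poly #|U|).
  apply: (big_ind (fun P : {poly R} => (size P <= _)%N)) => [|P Q szP szQ|U US].
  - by rewrite size_poly0.
  - by rewrite (leq_trans (size_polyD _ _)) // geq_max szP.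
  - rewrite (leq_trans (size_scale_leq _ _)) // size_ffact_poly ltnS.
    exact: subset_leq_card.
move=> m mn.
(* Each factor is [H i] plus the indicator of [i \in J] times [G i - H i]; after expansion J enters
   only through the events [U \subset J]. *)
have expand J : \prod_(i in S) (if i \in J then G i else H i) =
    \sum_(U : {set 'I_n} | U \subset S) (U \subset J)%:R * c U.
  pose A i : R := if i \in S then (i \in J)%:R * (G i - H i) else 0.
  pose B i : R := if i \in S then H i else 1.
  rewrite big_mkcond (eq_bigr (fun i => A i + B i)) => [|i _]; last first.
    rewrite /A /B; case: (i \in S); last by rewrite add0r.
    by case: (i \in J); rewrite ?mul1r ?subrK ?mul0r ?add0r.
  rewrite bigA_distr [RHS]big_mkcond; apply: eq_bigr => U _.
  have [US|/fintype.subsetPn[i iU iS]] := boolP (U \subset S); last first.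
    by rewrite (bigD1 i) //= iU /A (negbTE iS) mul0r.
  have -> : (U \subset J)%:R = \prod_(i in U) (i \in J)%:R :> R.
    have [UJ|/fintype.subsetPn[i iU iJ]] := boolP (U \subset J).
      by rewrite big1 // => i iU; rewrite (fintype.subsetP UJ).
    by rewrite (bigD1 i) //= (negbTE iJ) mul0r.
  rewrite /c mulrA -big_split /= [X in _ = X * _]big_mkcond.
  rewrite [X in _ = _ * X]big_mkcond.
  rewrite -big_split; apply: eq_bigr => i _ /=; rewrite !inE /A /B.
  case: ifP => iU /=; first by rewrite (fintype.subsetP US) // mulr1.
  by rewrite mul1r.
rewrite (eq_bigr _ (fun J _ => expand J)) exchange_big /= horner_sum mulr_sumr.
apply: eq_bigr => U _; rewrite -mulr_suml hornerZ horner_ffact_poly.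
have [Um|mU] := leqP #|U| m; last first.
  rewrite (ffact_small mU) mulr0n !mulr0 big1 ?mul0r // => J /eqP Jm.
  case: fintype.subsetP => // UJ.
  have := subset_leq_card (introT fintype.subsetP UJ).
  by rewrite Jm leqNgt mU.
have -> : \sum_(J : {set 'I_n} | #|J| == m) (U \subset J)%:R =
    #|[set J : {set 'I_n} | (U \subset J) && (#|J| == m)]|%:R :> R.
  rewrite -sum1_card natr_sum [RHS]big_mkcond [LHS]big_mkcond; apply: eq_bigr => J _.
  by rewrite inE andbC; case: (#|J| == m); case: (U \subset J).
apply: (mulIf (nff U)); rewrite card_supersets // mulrAC -natrM.
rewrite bin_sub_ffact ?Um // natrM.
have := nff U; set a : R := (n ^_ _)%:R => a0; by field.
Qed.
End SubsetAverages.

(** * Resampling coordinates *)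

Section LocalFunctions.

Variables (R : realType) (q n : nat).
Notation cube := (qcube q n).
Implicit Types (J S : {set 'I_n}) (m D : nat) (x y : cube) (f : cube -> R).
Implicit Types (nu : 'I_q -> 'I_q -> R).

Lemma sum_cube_prod (F : 'I_n -> 'I_q -> R) :
  \sum_(y : cube) \prod_i F i (y i) = \prod_i \sum_c F i c.
Proof. by rewrite bigA_distr_bigA. Qed.

(* The span of the functions depending on at most [D] coordinates. *)
Inductive local_fun D : (cube -> R) -> Prop :=
| LocalProd S (g : 'I_n -> 'I_q -> R) : (#|S| <= D)%N ->
    local_fun D (fun x => \prod_(i in S) g i (x i))
| LocalLin c f h : local_fun D f -> local_fun D h ->
    local_fun D (fun x => c * f x + h x).

Lemma local_fun_cst D (a : R) : local_fun D (fun=> a).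
Proof.
(* Constants come from the empty product, which is 1. *)
have H0 : local_fun D (fun x => \prod_(i in (finset.set0 : {set 'I_n})) 0).
  by apply: (LocalProd (fun _ _ => 0)); rewrite cards0.
suff -> : (fun=> a) = (fun x : cube => (a - 1) *
    \prod_(i in (finset.set0 : {set 'I_n})) 0 +
    \prod_(i in (finset.set0 : {set 'I_n})) 0) by exact: LocalLin.
by apply/funext => x; rewrite big_set0 mulr1 subrK.
Qed.

Lemma local_funZ D a f : local_fun D f -> local_fun D (fun x => a * f x).
Proof.
move=> Lf; have := LocalLin a Lf (local_fun_cst D 0).
by congr local_fun; apply/funext => x; rewrite addr0.
Qed.

Lemma local_fun_sum D (I : Type) (r : seq I) (p : pred I) (a : I -> R)
    (F : I -> cube -> R) : (forall i, p i -> local_fun D (F i)) ->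
  local_fun D (fun x => \sum_(i <- r | p i) a i * F i x).
Proof.
move=> LF; elim: r => [|i r IHr].
  have := local_fun_cst D 0; congr local_fun.
  by apply/funext => x; rewrite big_nil.
case pi : (p i); last first.
  by move: IHr; congr local_fun; apply/funext => x; rewrite big_cons pi.
have := LocalLin (a i) (LF i pi) IHr; congr local_fun.
by apply/funext => x; rewrite big_cons pi.
Qed.

(* [nu b] is the law of the letter by which [b] is replaced. *)
Definition resample nu J x y : R :=
  \prod_i (if i \in J then (x i == y i)%:R else nu (x i) (y i)).

Definition avg_resample nu m f x : R :=
  'C(n, m)%:R^-1 *
  \sum_(J : {set 'I_n} | #|J| == m) \sum_y resample nu J x y * f y.

Lemma avg_resample_lin nu m c f h x :
  avg_resample nu m (fun y => c * f y + h y) x =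
  c * avg_resample nu m f x + avg_resample nu m h x.
Proof.
rewrite /avg_resample mulrCA -mulrDr; congr (_ * _).
rewrite mulr_sumr -big_split /=; apply: eq_bigr => J _.
rewrite mulr_sumr -big_split /=; apply: eq_bigr => y _.
by rewrite mulrDr mulrCA.
Qed.

Section MarkovKernel.

Variable nu : 'I_q -> 'I_q -> R.
Hypothesis nu_sum1 : forall b, \sum_c nu b c = 1.

Lemma sum_delta (g : 'I_q -> R) b : \sum_c (b == c)%:R * g c = g b.
Proof.
rewrite (bigD1 b) //= eqxx mul1r big1 ?addr0 // => c cb.
by rewrite eq_sym (negbTE cb) mul0r.
Qed.

(** Coordinates are resampled independently, so the mean of a product factorizes. The result is
    again a product over S, which is why [local_fun D] is stable. *)
Lemma resample_prod J S (g : 'I_n -> 'I_q -> R) x :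
  \sum_y resample nu J x y * \prod_(i in S) g i (y i) =
  \prod_(i in S) (if i \in J then g i (x i) else \sum_c nu (x i) c * g i c).
Proof.
transitivity (\sum_(y : cube) \prod_i
    ((if i \in J then (x i == y i)%:R else nu (x i) (y i)) *
     (if i \in S then g i (y i) else 1))).
  by apply: eq_bigr => y _; rewrite big_split -big_mkcond.
rewrite (sum_cube_prod (fun i c => (if i \in J then (x i == c)%:R else nu (x i) c)
  * (if i \in S then g i c else 1))) [RHS]big_mkcond; apply: eq_bigr => i _.
case: (i \in S); case: (i \in J) => //; first exact: sum_delta.
  by rewrite (sum_delta (fun=> 1)).
by under eq_bigr => c _ do rewrite mulr1.
Qed.

Lemma resample_sum1 J x : \sum_y resample nu J x y = 1.
Proof.
have := @resample_prod J finset.set0 (fun _ _ => 1) x; rewrite [RHS]big_set0 => <-.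
by apply: eq_bigr => y _; rewrite big_set0 mulr1.
Qed.

Lemma local_fun_avg_resample D m f :
  local_fun D f -> local_fun D (avg_resample nu m f).
Proof.
elim=> [S g SD|c h k _ IHh _ IHk]; last first.
  have := LocalLin c IHh IHk; congr local_fun.
  by apply/funext => x; rewrite -avg_resample_lin.
rewrite /avg_resample; apply: local_funZ.
have LJ J : local_fun D (fun x => \prod_(i in S)
    (if i \in J then g i (x i) else \sum_c nu (x i) c * g i c)).
  exact: (LocalProd (fun i b =>
     if i \in J then g i b else \sum_c nu b c * g i c)).
have := local_fun_sum (index_enum _) (fun=> 1) (fun J (_ : #|J| == m) => LJ J).
congr local_fun; apply/funext => x; apply: eq_bigr => J _.
by rewrite resample_prod mul1r.
Qed.

(** The degree in m is bounded independently of n, so both interpolation bounds apply. By linearity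
    only products matter, and these are [sum_draws_poly]. *)
Lemma avg_resample_poly D f x : local_fun D f ->
  exists2 P : {poly R}, (size P <= D.+1)%N &
    forall m, (m <= n)%N -> avg_resample nu m f x = P.[m%:R].
Proof.
elim=> [S g SD|c h k _ [P szP PE] _ [Q szQ QE]]; last first.
  exists (c *: P + Q) => [|m mn].
    rewrite (leq_trans (size_polyD _ _)) // geq_max szQ andbT.
    exact: leq_trans (size_scale_leq _ _) szP.
  by rewrite avg_resample_lin PE // QE // !hornerE.
have [P szP PE] := @sum_draws_poly R n S (fun i => g i (x i))
  (fun i => \sum_c nu (x i) c * g i c).
exists P => [|m mn]; first by rewrite (leq_trans szP) // ltnS.
rewrite /avg_resample; under eq_bigr => J _ do rewrite resample_prod.
by rewrite PE // mulKf // pnatr_eq0 -lt0n bin_gt0.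
Qed.

Lemma sumr_draws m (B : R) :
  \sum_(J : {set 'I_n} | #|J| == m) B = B *+ 'C(n, m).
Proof.
rewrite sumr_const; congr (_ *+ _).
by rewrite -[X in 'C(X, _)]card_ord -card_draws; apply: eq_card => J; rewrite inE.
Qed.

Lemma avg_resample_cst m (b : R) x : (m <= n)%N ->
  avg_resample nu m (fun=> b) x = b.
Proof.
move=> mn; rewrite /avg_resample (eq_bigr (fun=> b)) => [|J _]; last first.
  by rewrite -mulr_suml resample_sum1 mul1r.
by rewrite sumr_draws -[b *+ _]mulr_natl mulKf // pnatr_eq0 -lt0n bin_gt0.
Qed.

Lemma avg_resample_id f x : avg_resample nu n f x = f x.
Proof.
rewrite /avg_resample binn invr1 mul1r (big_pred1 [set: 'I_n]); last first.
  by move=> J; rewrite /= eqEcard finset.subsetT cardsT card_ord eqn_leq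
    -[X in (_ <= X)%N](card_ord n) max_card.
rewrite (bigD1 x) //= big1 => [|y yx].
  rewrite addr0 /resample big1 ?mul1r // => i _.
  by rewrite finset.in_setT eqxx.
rewrite /resample; have /existsP[i xy] : [exists i, x i != y i].
  apply: contraNT yx => /existsPn xy; apply/eqP/ffunP => i.
  by have := xy i; rewrite negbK => /eqP.
by rewrite (bigD1 i) //= finset.in_setT (negbTE xy) !mul0r.
Qed.

Hypothesis nu_ge0 : forall b c, 0 <= nu b c.

Lemma resample_ge0 J x y : 0 <= resample nu J x y.
Proof. by apply: prodr_ge0 => i _; case: ifP. Qed.

Lemma avg_resample_bound m f x (B : R) : (m <= n)%N ->
  (forall y, `|f y| <= B) -> `|avg_resample nu m f x| <= B.
Proof.
move=> mn fB; rewrite /avg_resample normrM ger0_norm ?invr_ge0 //.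
rewrite mulrC ler_pdivrMr ?ltr0n ?bin_gt0 // mulrC mulr_natl.
rewrite -sumr_draws.
apply: le_trans (ler_norm_sum _ _ _) _; apply: ler_sum => J _.
apply: le_trans (ler_norm_sum _ _ _) _.
rewrite -[leRHS]mul1r -(resample_sum1 J x) mulr_suml.
apply: ler_sum => y _; rewrite normrM (ger0_norm (resample_ge0 _ _ _)).
by rewrite ler_wpM2l ?resample_ge0.
Qed.

End MarkovKernel.
End LocalFunctions.

(** * Polynomial functions and sums of squares on the cube *)

Section PolynomialFunctions.

Variables (R : realType) (q n : nat).
Notation cube := (qcube q n).
Implicit Types (m r : nat) (x y : cube) (f h : cube -> R) (p : rpoly R n).

Lemma evalQ_mul p1 p2 x : evalQ (p1 * p2) x = evalQ p1 x * evalQ p2 x.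
Proof. exact: mpoly.mevalM. Qed.

(** Both bounds depend on polynomials only through their values on the cube, so degrees and sums of
    squares are attached to functions. *)
Definition polyfun m h := exists2 p : rpoly R n, polys_le m p & evalQ p =1 h.

Definition sosfun r h := exists2 s : rpoly R n, sos r s & evalQ s =1 h.

Lemma polyfun_ext m f h : f =1 h -> polyfun m f -> polyfun m h.
Proof. by move=> fh [p pm pf]; exists p => // x; rewrite pf. Qed.

Lemma sosfun_ext r f h : f =1 h -> sosfun r f -> sosfun r h.
Proof. by move=> fh [p pm pf]; exists p => // x; rewrite pf. Qed.

Lemma polyfunW m1 m2 f : (m1 <= m2)%N -> polyfun m1 f -> polyfun m2 f.
Proof.
move=> le12 [p pm pf]; exists p => //; rewrite /polys_le /=.
exact: leq_trans pm _.
Qed.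

Lemma sosfunW r1 r2 f : (r1 <= r2)%N -> sosfun r1 f -> sosfun r2 f.
Proof.
move=> le12 [s [ps [psr sE]] sf]; exists s => //; exists ps; split => // p pps.
by apply: leq_trans (psr p pps) _.
Qed.

Lemma polyfun_cst m (c : R) : polyfun m (fun=> c).
Proof.
exists (mpoly.mpolyC n c); last by move=> x; exact: mpoly.mevalC.
rewrite /polys_le /= mpoly.mmeasureC; by case: (c != 0).
Qed.

Lemma polyfunD m f h : polyfun m f -> polyfun m h -> polyfun m (fun x => f x + h x).
Proof.
move=> [p pm pf] [p' pm' ph]; exists (p + p').
  rewrite /polys_le /= (leq_trans (mpoly.mmeasureD_le _ _ _)) // geq_max.
  by rewrite [X in X && _]pm.
by move=> x; rewrite -pf -ph; exact: mpoly.mevalD.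
Qed.

Lemma polyfunM m1 m2 f h : polyfun m1 f -> polyfun m2 h ->
  polyfun (m1 + m2) (fun x => f x * h x).
Proof.
move=> [p pm pf] [p' pm' ph]; exists (p * p'); last first.
  by move=> x; rewrite -pf -ph; exact: mpoly.mevalM.
rewrite /polys_le /= in pm pm' *.
(* The size of a product is given by [msizeM] for nonzero factors; zero factors are treated
   apart. *)
have [->|p0] := eqVneq p 0; first by rewrite mul0r mpoly.mmeasure0.
have [->|p'0] := eqVneq p' 0; first by rewrite mulr0 mpoly.mmeasure0.
rewrite mpoly.msizeM // -ltnS prednK; last first.
  by rewrite addn_gt0 lt0n mpoly.mmeasure_poly_eq0 p0.
by rewrite -addnS -addSn leq_add.
Qed.

Lemma polyfunZ m c f : polyfun m f -> polyfun m (fun x => c * f x).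
Proof. by move=> pf; apply: (polyfunM (polyfun_cst 0 c) pf). Qed.

Lemma polyfun_sum m (I : Type) (s : seq I) (P : pred I) (F : I -> cube -> R) :
  (forall i, P i -> polyfun m (F i)) ->
  polyfun m (fun x => \sum_(i <- s | P i) F i x).
Proof.
move=> PF; elim: s => [|i s IHs].
  by apply: polyfun_ext (polyfun_cst m 0) => x; rewrite big_nil.
case Pi : (P i); last by apply: polyfun_ext IHs => x; rewrite big_cons Pi.
by apply: polyfun_ext (polyfunD (PF i Pi) IHs) => x; rewrite big_cons Pi.
Qed.

Lemma polyfun_prod (I : Type) (s : seq I) (P : pred I) (k : I -> nat)
    (F : I -> cube -> R) : (forall i, P i -> polyfun (k i) (F i)) ->
  polyfun (\sum_(i <- s | P i) k i) (fun x => \prod_(i <- s | P i) F i x).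
Proof.
move=> PF; elim: s => [|i s IHs].
  by rewrite big_nil; apply: polyfun_ext (polyfun_cst 0 1) => x; rewrite big_nil.
rewrite big_cons; case: ifP => Pi; last first.
  by apply: polyfun_ext IHs => x; rewrite big_cons Pi.
by apply: polyfun_ext (polyfunM (PF i Pi) IHs) => x; rewrite big_cons Pi.
Qed.

Lemma polyfun_coord i : polyfun 1 (fun x : cube => (x i)%:R).
Proof.
exists (mpoly.mpolyX R (mpoly.mnm1 i)); last by move=> x; exact: mpoly.mevalXU.
by rewrite /polys_le /= mpoly.msizeX mpoly.mdeg1.
Qed.

(** The Lagrange polynomial of the letter b, with the q - 1 other letters as roots. This is the
    source of the factor q - 1 in all degrees. *)
Lemma polyfun_indic i (b : 'I_q) : polyfun (q - 1) (fun x : cube => (x i == b)%:R).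
Proof.
have -> : (q - 1 = \sum_(c : 'I_q | c != b) 1)%N.
  by rewrite sum1_card cardC1 card_ord subn1.
have PF (c : 'I_q) : c != b ->
    polyfun 1 (fun x : cube => (b%:R - c%:R)^-1 * ((x i)%:R - c%:R)).
  move=> _; apply: polyfunZ; apply: polyfunD; first exact: polyfun_coord.
  exact: polyfun_cst.
apply: polyfun_ext (polyfun_prod _ PF) => x.
have [->|xb] := eqVneq (x i) b.
  rewrite big1 // => c cb; rewrite mulVf // subr_eq0 eqr_nat eq_sym.
  exact: cb.
by rewrite (bigD1 (x i)) //= subrr mulr0 mul0r.
Qed.

(** A monomial of degree at most m involves at most m variables. *)
Lemma local_polyfun m f : polyfun m f -> local_fun m f.
Proof.
move=> [p pm pf].
pose S (a : mpoly.multinom n) : {set 'I_n} := finset (fun i => a i != 0%N).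
have := @local_fun_sum R q n m _ (mpoly.msupp p) (fun a => a \in mpoly.msupp p)
  (fun a => mpoly.mcoeff a p) (fun a x => \prod_(i in S a) (x i)%:R ^+ a i).
have E : (fun x : cube => \sum_(a <- mpoly.msupp p | a \in mpoly.msupp p)
     mpoly.mcoeff a p * \prod_(i in S a) (x i)%:R ^+ a i) = f.
  apply/funext => x; rewrite -pf /evalQ mpoly.mevalE -big_seq.
  apply: eq_bigr => a _; congr (_ * _); rewrite big_mkcond.
  apply: eq_bigr => i _; rewrite inE /cube_point; case: eqP => // ->.
  by rewrite expr0.
rewrite E; apply => a /mpoly.msize_mdeg_lt am.
apply: (LocalProd (fun i b => b%:R ^+ a i)).
rewrite -ltnS (leq_trans _ (leq_trans am pm)) // ltnS mpoly.mdegE -sum1_card.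
rewrite big_mkcond leq_sum // => i _; rewrite inE -lt0n.
by case: (a i).
Qed.

Lemma sosfun_sq r c f : 0 <= c -> polyfun r f -> sosfun r (fun x => c * f x ^+ 2).
Proof.
move=> c0 /(polyfunZ (Num.sqrt c)) [p pr pf]; exists (p ^+ 2).
  exists [:: p]; split; last by rewrite big_seq1.
  by move=> p'; rewrite inE => /eqP ->.
by move=> x; rewrite expr2 evalQ_mul pf -expr2 exprMn sqr_sqrtr.
Qed.

Lemma sosfunD r f h : sosfun r f -> sosfun r h -> sosfun r (fun x => f x + h x).
Proof.
move=> [s [ps [psr ->]] sf] [s' [ps' [psr' ->]] sh].
exists (\sum_(p <- ps ++ ps') p ^+ 2).
  exists (ps ++ ps'); split=> // p; rewrite mem_cat => /orP[]; [exact: psr|].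
  exact: psr'.
by move=> x; rewrite big_cat -sf -sh; exact: mpoly.mevalD.
Qed.

Lemma sosfun0 r : sosfun r (fun=> 0).
Proof.
exists 0; last by move=> x; exact: mpoly.meval0.
by exists [::]; split => //; rewrite big_nil.
Qed.

Lemma sosfun_sum r (I : Type) (s : seq I) (P : pred I) (F : I -> cube -> R) :
  (forall i, P i -> sosfun r (F i)) ->
  sosfun r (fun x => \sum_(i <- s | P i) F i x).
Proof.
move=> PF; elim: s => [|i s IHs].
  by apply: sosfun_ext (sosfun0 r) => x; rewrite big_nil.
case Pi : (P i); last by apply: sosfun_ext IHs => x; rewrite big_cons Pi.
by apply: sosfun_ext (sosfunD (PF i Pi) IHs) => x; rewrite big_cons Pi.
Qed.

End PolynomialFunctions.

(** * Sums of squares from uniform resampling and extrapolation *)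

Section ShiftedLocalFunctions.

Variables (R : realType) (q n : nat).
Hypothesis q_gt0 : (0 < q)%N.
Notation cube := (qcube q n).
Implicit Types (x y : cube) (f : cube -> R).

Definition unif (b c : 'I_q) : R := q%:R^-1.

Lemma unif_sum1 b : \sum_c unif b c = 1.
Proof.
by rewrite sumr_const card_ord -[LHS]mulr_natl mulfV // pnatr_eq0 -lt0n.
Qed.

(** An indicator is its own square, so for fixed y the kernel is a nonnegative multiple of the
    square of a polynomial in x. *)
Lemma resample_unif (J : {set 'I_n}) x y : resample unif J x y =
  q%:R^-1 ^+ #|~: J| * (\prod_(i in J) (x i == y i)%:R) ^+ 2.
Proof.
rewrite /resample (bigID (mem J)) /= mulrC; congr (_ * _).
  rewrite (eq_bigr (fun=> q%:R^-1)) => [|i /negbTE -> //].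
  rewrite prodr_const; congr (_ ^+ _); apply: eq_card => i.
  by rewrite finset.in_setC.
rewrite -prodrXl; apply: eq_bigr => i ->; case: (x i == y i).
  by rewrite expr1n.
by rewrite expr0n.
Qed.

Lemma sosfun_avg_resample m f : (forall y, 0 <= f y) ->
  sosfun ((q - 1) * m) (avg_resample unif m f).
Proof.
move=> f0; pose a (J : {set 'I_n}) y := 'C(n, m)%:R^-1 * f y * q%:R^-1 ^+ #|~: J|.
apply: (@sosfun_ext _ _ _ _ (fun x => \sum_(J : {set 'I_n} | #|J| == m)
   \sum_y a J y * (\prod_(i in J) (x i == y i)%:R) ^+ 2)) => [x|].
  rewrite /avg_resample mulr_sumr; apply: eq_bigr => J _.
  by rewrite mulr_sumr; apply: eq_bigr => y _; rewrite resample_unif /a; ring.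
apply: sosfun_sum => J /eqP <-; apply: sosfun_sum => y _; apply: sosfun_sq.
  by rewrite !mulr_ge0 ?exprn_ge0 ?invr_ge0.
rewrite mulnC -sum_nat_const; apply: polyfun_prod => i _.
exact: polyfun_indic.
Qed.

(* [f] is a combination with bounded coefficients of averages of functions of
   at most [r] coordinates, and a nonnegative function of a set of [r]
   coordinates is a sum of squares of degree [(q - 1) r]. *)
Lemma sosfun_shift D r f (B : R) : (0 < D <= r)%N -> (r <= n)%N ->
    local_fun D f -> (forall x, `|f x| <= B) ->
  sosfun ((q - 1) * r)
    (fun x => f x + D.+1%:R * (2 * D%:R * n%:R / r%:R) ^+ D * B).
Proof.
move=> Dr rn Lf fB; have [c [cK cP]] := @grid_extrapolation R D n r Dr rn.
set K : R := D.+1%:R * _ in cK *.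
have cr (i : 'I_D.+1) : (i * (r %/ D) <= r)%N.
  rewrite (leq_trans _ (leq_divM r D)) // mulnC leq_mul2l.
  by rewrite -ltnS ltn_ord orbT.
have B0 : 0 <= B.
  by apply: le_trans (fB [ffun=> Ordinal q_gt0]); apply: normr_ge0.
(* This shift makes each term nonnegative, so that its averages become sums of squares. *)
have cB i y : 0 <= c i * f y + `|c i| * B.
  rewrite -lerBlDr sub0r; have := ler_norm (- (c i * f y)).
  rewrite normrN normrM => le1; rewrite -lerN2 opprK.
  by apply: le_trans le1 _; rewrite ler_wpM2l.
have fE x : f x = \sum_i c i * avg_resample unif (i * (r %/ D)) f x.
  have [P szP PE] := avg_resample_poly unif_sum1 x Lf.
  rewrite -{1}(avg_resample_id unif f x) PE // cP //.
  by apply: eq_bigr => i _; rewrite PE // (leq_trans (cr i)).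
(* The shifts only add up to B times the sum of the [|c i|]; the rest of [K * B] is a nonnegative
   multiple of the square of 1. *)
pose h (x : cube) : R := \sum_(i < D.+1)
  avg_resample unif (i * (r %/ D)) (fun y => c i * f y + `|c i| * B) x +
  (K - \sum_i `|c i|) * B * 1 ^+ 2.
have : sosfun ((q - 1) * r) h.
  apply: sosfunD; last first.
    apply: (@sosfun_sq R q n _ _ (fun=> 1)); last exact: polyfun_cst.
    by rewrite mulr_ge0 // subr_ge0.
  apply: sosfun_sum => i _.
  apply: sosfunW (sosfun_avg_resample (i * (r %/ D)) (cB i)).
  by rewrite leq_mul2l cr orbT.
apply: sosfun_ext => x; rewrite /h.
rewrite expr1n mulr1 mulrBl fE mulr_suml addrCA addrC; congr (_ + _).
rewrite -sumrB; apply: eq_bigr => i _.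
rewrite avg_resample_lin avg_resample_cst ?addrK //; first exact: unif_sum1.
exact: leq_trans (cr i) rn.
Qed.

End ShiftedLocalFunctions.

(** * Kernels depending on the number of agreements *)

Section AgreementKernels.

Variables (R : realType) (q n : nat).
Hypothesis q_gt1 : (1 < q)%N.
Notation cube := (qcube q n).
Implicit Types (x y : cube) (f : cube -> R) (kappa : nat -> R).

Definition agree x y : {set 'I_n} := [set i | x i == y i].

(** The uniform law on the letters other than b: the set of agreements with x is then exactly J. *)
Definition alter (b c : 'I_q) : R := (b != c)%:R / (q - 1)%:R.

Lemma q_pred_neq0 : (q - 1)%:R != 0 :> R.
Proof. by rewrite pnatr_eq0 subn_eq0 -ltnNge. Qed.

Lemma alter_sum1 b : \sum_c alter b c = 1.
Proof.
rewrite -mulr_suml -natr_sum.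
have -> : (\sum_c (b != c) = q - 1)%N.
  rewrite -[in RHS](card_ord q) subn1 -(cardC1 b) -sum1_card [RHS]big_mkcond.
  by apply: eq_bigr => c _; rewrite inE eq_sym; case: (c == b).
by rewrite mulfV // q_pred_neq0.
Qed.

Lemma alter_ge0 b c : 0 <= alter b c.
Proof. by rewrite divr_ge0. Qed.

Lemma resample_alter (J : {set 'I_n}) x y : resample alter J x y =
  (J == agree x y)%:R * (q - 1)%:R ^- (n - #|J|).
Proof.
rewrite /resample; have [->|] := eqVneq J (agree x y).
  rewrite mul1r (bigID (mem (agree x y))) /= big1 ?mul1r => [|i]; last first.
    by move=> ixy; rewrite ixy; move: ixy; rewrite inE => ->.
  rewrite (eq_bigr (fun=> (q - 1)%:R^-1)) => [|i]; last first.
    move=> ixy; rewrite (negbTE ixy); move: ixy.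
    by rewrite inE /alter => ->; rewrite mul1r.
  rewrite prodr_const exprVn; congr (_ ^- _).
  have -> : (n - #|agree x y| = #|~: agree x y|)%N.
    by rewrite (cardsCs (~: _)) finset.setCK card_ord.
  by apply: eq_card => i; rewrite finset.in_setC.
rewrite mul0r => JE; have [i iJ] : exists i, (i \in J) != (i \in agree x y).
  apply/existsP; apply: contraNT JE => /existsPn JE; apply/eqP/finset.setP => i.
  by have := JE i; rewrite negbK => /eqP.
rewrite (bigD1 i) //=; move: iJ; rewrite inE /alter.
by case: (i \in J); case: (x i == y i); rewrite //= ?mul0r.
Qed.

(** The points with m agreements form a sphere of ['C(n, m) * (q - 1) ^ (n - m)] points, over which
    f has mean [avg_resample alter m f x]. *)
Lemma sum_agree kappa f x :
  \sum_y kappa #|agree x y| * f y =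
  \sum_(m < n.+1) kappa m * (q - 1)%:R ^+ (n - m) * 'C(n, m)%:R *
     avg_resample alter m f x.
Proof.
transitivity (\sum_(m < n.+1) \sum_y (#|agree x y| == m)%:R * (kappa m * f y)).
  rewrite exchange_big; apply: eq_bigr => y _.
  have agn : (#|agree x y| < n.+1)%N.
    by rewrite ltnS -[X in (_ <= X)%N](card_ord n) max_card.
  rewrite (bigD1 (Ordinal agn)) //= eqxx mul1r big1 ?addr0 // => m mE.
  have [ag_m|] := eqVneq #|agree x y| m; last by rewrite mul0r.
  by case/eqP: mE; apply: val_inj.
apply: eq_bigr => m _; rewrite /avg_resample -!mulrA mulVKf; last first.
  by rewrite pnatr_eq0 -lt0n bin_gt0 -ltnS.
rewrite exchange_big /= !mulr_sumr; apply: eq_bigr => y _.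
rewrite -mulr_suml (eq_bigr (fun J : {set 'I_n} =>
  (J == agree x y)%:R * (q - 1)%:R ^- (n - m))); last first.
  by move=> J /eqP <-; rewrite resample_alter.
rewrite -mulr_suml.
have -> : \sum_(J : {set 'I_n} | #|J| == m) (J == agree x y)%:R =
    (#|agree x y| == m)%:R :> R.
  rewrite big_mkcond (bigD1 (agree x y)) //= eqxx big1 ?addr0 => [|J JE].
    by case: (_ == _ :> nat).
  by rewrite (negbTE JE); case: ifP.
have := expf_neq0 (n - m) q_pred_neq0.
by set c := _ ^+ _ => c0; field.
Qed.

Lemma local_fun_agree_kernel D kappa f : local_fun D f ->
  local_fun D (fun x => \sum_y kappa #|agree x y| * f y).
Proof.
move=> Lf; have -> : (fun x => \sum_y kappa #|agree x y| * f y) = (fun x =>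
    \sum_(m < n.+1) kappa m * (q - 1)%:R ^+ (n - m) * 'C(n, m)%:R *
      avg_resample alter m f x).
  by apply/funext => x; rewrite sum_agree.
apply: (local_fun_sum _ (fun m : 'I_n.+1 =>
  kappa m * (q - 1)%:R ^+ (n - m) * 'C(n, m)%:R) (F := fun m : 'I_n.+1 => _)).
by move=> m _; apply: local_fun_avg_resample alter_sum1 _ _ _ Lf.
Qed.

(** The kernel mixes the sphere averages with nonnegative weights. The one with m agreements differs
    from f x by at most a constant times (n - m) / n, by [grid_modulus]. *)
Lemma agree_kernel_deviation D kappa f x (B : R) :
    (forall m, 0 <= kappa m) -> (0 < D <= n)%N ->
    local_fun D f -> (forall y, `|f y| <= B) ->
  `|\sum_y kappa #|agree x y| * f y - (\sum_y kappa #|agree x y|) * f x| <=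
  2 * D.+1%:R * (2 * D%:R) ^+ D * B / n%:R *
    \sum_y kappa #|agree x y| * (n - #|agree x y|)%:R.
Proof.
move=> k0 Dn Lf fB.
pose W (m : nat) := kappa m * (q - 1)%:R ^+ (n - m) * 'C(n, m)%:R.
have W0 m : 0 <= W m by rewrite !mulr_ge0 // exprn_ge0.
have [P szP PE] := avg_resample_poly alter_sum1 x Lf.
have -> : \sum_y kappa #|agree x y| = \sum_(m < n.+1) W m.
  transitivity (\sum_y kappa #|agree x y| * 1).
    by apply: eq_bigr => y _; rewrite mulr1.
  rewrite (sum_agree kappa (fun=> 1)); apply: eq_bigr => m _.
  by rewrite (avg_resample_cst alter_sum1) ?mulr1 // -ltnS.
have -> : \sum_y kappa #|agree x y| * (n - #|agree x y|)%:R =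
    \sum_(m < n.+1) W m * (n - m)%:R.
  transitivity (\sum_y (kappa #|agree x y| * (n - #|agree x y|)%:R) * 1).
    by apply: eq_bigr => y _; rewrite mulr1.
  rewrite (sum_agree (fun m => kappa m * (n - m)%:R) (fun=> 1)).
  apply: eq_bigr => m _; have mn : (m <= n)%N by rewrite -ltnS.
  by rewrite (avg_resample_cst alter_sum1) // mulr1 /W; ring.
rewrite sum_agree mulr_suml -sumrB mulr_sumr.
apply: le_trans (ler_norm_sum _ _ _) _; apply: ler_sum => m _.
have mn : (m <= n)%N by rewrite -ltnS.
rewrite -/(W m) -mulrBr normrM (ger0_norm (W0 m)) mulrCA ler_wpM2l //.
rewrite -[X in _ - X](avg_resample_id alter) !PE // -{1}(subKn mn).
have PB k : (k <= n)%N -> `|P.[k%:R]| <= B.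
  by move=> kn; rewrite -PE //; apply: (avg_resample_bound alter_sum1 alter_ge0).
apply: le_trans (grid_modulus Dn (leq_subr m n) szP PB) _.
by rewrite mulrA mulrAC.
Qed.

End AgreementKernels.

(** * Krawtchouk kernels *)

Section KrawtchoukKernels.

Variables (R : realType) (q n : nat).
Hypothesis q_gt1 : (1 < q)%N.
Notation cube := (qcube q n).
Implicit Types (x y : cube) (S T : {set 'I_n}) (l : 'I_n) (b : nat -> R).

Lemma intQ_prod (F : 'I_n -> 'I_q -> R) :
  intQ (fun y : cube => \prod_i F i (y i)) = \prod_i (q%:R^-1 * \sum_c F i c).
Proof.
rewrite /intQ -mulr_sumr sum_cube_prod card_ffun !card_ord natrX big_split /=.
by rewrite prodr_const card_ord exprVn.
Qed.

Lemma intQ_sum (I : Type) (s : seq I) (P : pred I) (F : I -> cube -> R) :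
  intQ (fun y => \sum_(i <- s | P i) F i y) = \sum_(i <- s | P i) intQ (F i).
Proof. by rewrite /intQ exchange_big; apply: eq_bigr => y _; rewrite mulr_sumr. Qed.

Lemma intQZ (c : R) (F : cube -> R) : intQ (fun y => c * F y) = c * intQ F.
Proof. by rewrite /intQ mulr_sumr; apply: eq_bigr => y _; rewrite mulrCA. Qed.

(** The sum of the nontrivial characters of Z/q at [x l - y l]: q - 1 at an agreement, -1
    otherwise. *)
Definition letter x y l : R := q%:R * (x l == y l)%:R - 1.

(** The k-th moment of [letter] when [y l] is uniform. *)
Definition moment (k : nat) : R :=
  q%:R^-1 * ((q%:R - 1) ^+ k + (q%:R - 1) * (- 1) ^+ k).

Lemma q_neq0 : q%:R != 0 :> R.
Proof. by rewrite pnatr_eq0 -lt0n ltnW. Qed.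

Lemma moment0 : moment 0 = 1.
Proof. by rewrite /moment !expr0 mulr1 addrC subrK mulVf // q_neq0. Qed.

Lemma moment1 : moment 1 = 0.
Proof. by rewrite /moment !expr1 mulrN1 subrr mulr0. Qed.

Lemma moment2 : moment 2 = q%:R - 1.
Proof. by rewrite /moment; field; exact: q_neq0. Qed.

Lemma moment3 : moment 3 = (q%:R - 2) * (q%:R - 1).
Proof. by rewrite /moment; field; exact: q_neq0. Qed.

(** For k > 0 the power (q - 1)^k is at least q - 1 and absorbs the signed term. Nonnegativity
    allows terms to be dropped in [intQ_letter_kraw2]. *)
Lemma moment_ge0 k : 0 <= moment k.
Proof.
have q1 : 1 <= q%:R - 1 :> R by rewrite lerBrDr -(natrD _ 1 1) ler_nat.
rewrite mulr_ge0 ?invr_ge0 //; case: k => [|k].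
  by rewrite !expr0 mulr1 addr_ge0 // (le_trans _ q1).
rewrite exprS -mulrDr mulr_ge0 ?(le_trans _ q1) //.
apply: (@le_trans _ _ (1 + (-1) ^+ k.+1)); last by rewrite lerD2r exprn_ege1.
by rewrite -signr_odd; case: odd; rewrite ?expr1 ?subrr ?expr0 ?addr_ge0.
Qed.

Lemma intQ_letters x (e : 'I_n -> nat) :
  intQ (fun y => \prod_i letter x y i ^+ e i) = \prod_i moment (e i).
Proof.
rewrite (intQ_prod (fun i c => (q%:R * (x i == c)%:R - 1) ^+ e i)).
apply: eq_bigr => i _; rewrite /moment (bigD1 (x i)) //= eqxx mulr1.
congr (_ * (_ + _)); rewrite (eq_bigr (fun=> (-1) ^+ e i)) => [|c cx].
  rewrite sumr_const cardC1 card_ord -[LHS]mulr_natl -subn1 natrB //.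
  exact: ltnW.
by rewrite eq_sym (negbTE cx) mulr0 sub0r.
Qed.

Definition chi S x y : R := \prod_(i in S) letter x y i.

Lemma chiE S x y : chi S x y = \prod_i letter x y i ^+ (i \in S).
Proof. by rewrite /chi big_mkcond; apply: eq_bigr => i _; case: (i \in S). Qed.

(** Orthogonality: a coordinate in exactly one of S and T contributes the first moment, which is
    0. *)
Lemma intQ_chi2 x S T :
  intQ (fun y => chi S x y * chi T x y) = (S == T)%:R * (q%:R - 1) ^+ #|S|.
Proof.
have -> : (fun y => chi S x y * chi T x y) =
    (fun y => \prod_i letter x y i ^+ ((i \in S) + (i \in T))%N).
  apply/funext => y; rewrite !chiE -big_split.
  by apply: eq_bigr => i _; rewrite exprD.
rewrite intQ_letters; have [->|ST] := eqVneq S T.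
  rewrite mul1r -prodr_const [RHS]big_mkcond; apply: eq_bigr => i _.
  by case: (i \in T); rewrite ?moment2 ?moment0.
have [i iST] : exists i, (i \in S) != (i \in T).
  apply/existsP; apply: contraNT ST => /existsPn ST; apply/eqP/finset.setP => i.
  by have := ST i; rewrite negbK => /eqP.
by rewrite mul0r (bigD1 i) //=; case: (i \in S) (i \in T) iST => [] [] //= _;
  rewrite moment1 mul0r.
Qed.

Definition chi3 l S T : R := \prod_i moment ((i == l) + (i \in S) + (i \in T)).

Lemma intQ_chi3 x l S T :
  intQ (fun y => letter x y l * (chi S x y * chi T x y)) = chi3 l S T.
Proof.
rewrite /chi3 -(intQ_letters x (fun i => (i == l) + (i \in S) + (i \in T))%N).
congr intQ; apply/funext => y.
have -> : letter x y l = \prod_i letter x y i ^+ (i == l).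
  by rewrite (bigD1 l) //= eqxx expr1 big1 ?mulr1 // => i /negbTE ->.
rewrite !chiE -!big_split; apply: eq_bigr => i _ /=.
by rewrite !exprD mulrA.
Qed.

Lemma chi3_ge0 l S T : 0 <= chi3 l S T.
Proof. by apply: prodr_ge0 => i _; apply: moment_ge0. Qed.

Lemma chi3C l S T : chi3 l S T = chi3 l T S.
Proof. by apply: eq_bigr => i _; rewrite -addnA [X in (_ + X)%N]addnC addnA. Qed.

(** The coordinate l contributes the third moment; this leads to the linear term of [phi]. *)
Lemma chi3_diag l S : l \in S -> chi3 l S S = (q%:R - 2) * (q%:R - 1) ^+ #|S|.
Proof.
move=> lS; rewrite /chi3 (bigD1 l) //= eqxx lS moment3 -mulrA; congr (_ * _).
rewrite -prodr_const [RHS](bigD1 l) //=; congr (_ * _).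
rewrite [RHS]big_mkcond [LHS]big_mkcond; apply: eq_bigr => i _ /=.
by case: eqVneq => //= il; case: (i \in S); rewrite ?moment2 ?moment0 // andbC.
Qed.

(** Every coordinate of S, including l, contributes a second moment; these pairs lead to the square
    root in [phi]. *)
Lemma chi3_del l S : l \in S -> chi3 l S (S :\ l) = (q%:R - 1) ^+ #|S|.
Proof.
move=> lS; rewrite /chi3 -prodr_const [RHS]big_mkcond; apply: eq_bigr => i _.
rewrite !inE; have [->|il] := eqVneq i l; first by rewrite lS moment2.
by case: (i \in S); rewrite ?moment2 ?moment0.
Qed.

(** The sum of [chi S x y] over the sets S of size k is the Krawtchouk polynomial of degree k in the
    distance of x and y. *)
Definition kraw b x y : R := \sum_(S : {set 'I_n}) b #|S| * chi S x y.

Lemma intQ_kraw2 b x : intQ (fun y => kraw b x y ^+ 2) =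
  \sum_(S : {set 'I_n}) b #|S| ^+ 2 * (q%:R - 1) ^+ #|S|.
Proof.
have -> : (fun y => kraw b x y ^+ 2) = (fun y => \sum_(S : {set 'I_n})
    \sum_(T : {set 'I_n}) (b #|S| * b #|T|) * (chi S x y * chi T x y)).
  apply/funext => y; rewrite expr2 /kraw mulr_suml; apply: eq_bigr => S _.
  by rewrite mulr_sumr; apply: eq_bigr => T _; rewrite mulrACA.
rewrite intQ_sum; apply: eq_bigr => S _; rewrite intQ_sum (bigD1 S) //=.
rewrite intQZ intQ_chi2 eqxx mul1r expr2 big1 ?addr0 // => T TS.
by rewrite intQZ intQ_chi2 eq_sym (negbTE TS) mul0r mulr0.
Qed.

(** In the expanded square all terms are nonnegative. Only the pairs (S, S), (S, S minus l) and (S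
    minus l, S) with l in S are kept; the last two account for the factor 2. *)
Lemma intQ_letter_kraw2 b x l : (forall k, 0 <= b k) ->
  \sum_(S : {set 'I_n} | l \in S) (q%:R - 1) ^+ #|S| *
     (b #|S| * ((q%:R - 2) * b #|S| + 2 * b #|S|.-1)) <=
  intQ (fun y => letter x y l * kraw b x y ^+ 2).
Proof.
move=> b0.
have -> : (fun y => letter x y l * kraw b x y ^+ 2) = (fun y =>
    \sum_(S : {set 'I_n}) \sum_(T : {set 'I_n})
       (b #|S| * b #|T|) * (letter x y l * (chi S x y * chi T x y))).
  apply/funext => y; rewrite expr2 /kraw mulrCA mulr_suml; apply: eq_bigr => S _.
  rewrite !mulr_sumr; apply: eq_bigr => T _; ring.
pose f S T := b #|S| * b #|T| * chi3 l S T.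
have f0 S T : 0 <= f S T by rewrite !mulr_ge0 ?b0 ?chi3_ge0.
have -> : intQ (fun y => \sum_(S : {set 'I_n}) \sum_(T : {set 'I_n})
    (b #|S| * b #|T|) * (letter x y l * (chi S x y * chi T x y))) =
    \sum_(S : {set 'I_n}) \sum_(T : {set 'I_n}) f S T.
  rewrite intQ_sum; apply: eq_bigr => S _; rewrite intQ_sum.
  by apply: eq_bigr => T _; rewrite intQZ intQ_chi3.
have delE S : l \in S -> #|S :\ l| = #|S|.-1.
  by move=> lS; rewrite (cardsD1 l S) lS.
rewrite [leRHS](bigID (fun S : {set 'I_n} => l \in S)) /=.
apply: (@le_trans _ _ (\sum_(S : {set 'I_n} | l \in S) (f S S + f S (S :\ l)) +
                       \sum_(S : {set 'I_n} | l \in S) f (S :\ l) S)).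
  rewrite -big_split /=; apply: ler_sum => S lS.
  rewrite /f chi3_diag // chi3C [chi3 l (_ :\ _) S]chi3C chi3_del // delE //.
  by rewrite le_eqVlt; apply/orP; left; apply/eqP; ring.
apply: lerD.
  apply: ler_sum => S lS; rewrite (bigD1 S) //= lerD2l (bigD1 (S :\ l)) /=.
    by rewrite lerDl sumr_ge0.
  by apply/eqP => /finset.setP/(_ l); rewrite !inE eqxx lS.
(* The first sets that avoid l are written as S minus l. *)
rewrite [leRHS](reindex_onto (fun S => S :\ l) (fun S => l |: S)) /=; last first.
  move=> S lS; rewrite setU1K //.
rewrite [leRHS](eq_bigl (fun S : {set 'I_n} => l \in S)) => [|S]; last first.
  rewrite !inE eqxx /=; apply/eqP/idP => [<-|lS]; first by rewrite !inE eqxx.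
  by rewrite finset.setD1K.
by apply: ler_sum => S lS; rewrite (bigD1 S) //= lerDl sumr_ge0.
Qed.

End KrawtchoukKernels.

(** * Windows of Krawtchouk polynomials with equal weights *)

Section WindowKernel.

Variables (R : realType) (q n : nat).
Hypothesis q_gt1 : (1 < q)%N.
Notation cube := (qcube q n).
Implicit Types (x y z : cube) (S T : {set 'I_n}) (b : nat -> R).

Lemma sumr_by_card (g : nat -> R) :
  \sum_(S : {set 'I_n}) g #|S| = \sum_(k < n.+1) g k * 'C(n, k)%:R.
Proof.
have ltS S : (#|S| < n.+1)%N by rewrite ltnS -[X in (_ <= X)%N](card_ord n) max_card.
rewrite (partition_big (fun S => Ordinal (ltS S)) predT) //=.
apply: eq_bigr => k _; rewrite [RHS]mulr_natr -sumr_draws.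
by apply: eq_big => [S|S /eqP <- //]; rewrite -val_eqE.
Qed.

(* Read off the generating polynomial [\prod_i (1 + letter i X)], which only
   depends on the number of agreements. *)
Lemma kraw_agree b : exists u : nat -> R, forall x y,
  kraw b x y = u #|agree x y|.
Proof.
exists (fun m => \sum_(k < n.+1) b k *
  ((1 + (q%:R - 1) *: 'X) ^+ m * (1 - 'X) ^+ (n - m) : {poly R})`_k) => x y.
have -> : (1 + (q%:R - 1) *: 'X) ^+ #|agree x y| * (1 - 'X) ^+ (n - #|agree x y|) =
    \prod_i (1 + letter R x y i *: 'X).
  rewrite [RHS](bigID (mem (agree x y))) /=.
  rewrite (eq_bigr (fun=> 1 + (q%:R - 1) *: 'X)) => [|i]; last first.
    by rewrite inE /letter => ->; rewrite mulr1.
  rewrite [X in _ = _ * X](eq_bigr (fun=> 1 - 'X)) => [|i]; last first.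
    by rewrite inE /letter => /negbTE ->; rewrite mulr0 sub0r scaleN1r.
  rewrite !prodr_const; congr (_ * _ ^+ _).
  have -> : (n - #|agree x y| = #|~: agree x y|)%N.
    by rewrite (cardsCs (~: _)) finset.setCK card_ord.
  by apply: eq_card => i; rewrite finset.in_setC.
have -> : \prod_i (1 + letter R x y i *: 'X) =
    \sum_(S : {set 'I_n}) chi R S x y *: 'X^#|S|.
  rewrite (eq_bigr (fun i => letter R x y i *: 'X + 1)) => [|i _]; last first.
    by rewrite addrC.
  rewrite bigA_distr; apply: eq_bigr => S _.
  rewrite -big_mkcond /= scaler_prod prodr_const; congr (_ *: _).
transitivity (\sum_(k < n.+1) \sum_(S : {set 'I_n})
    b k * (chi R S x y * (k == #|S| :> nat)%:R)); last first.
  apply: eq_bigr => k _; rewrite coef_sum mulr_sumr; apply: eq_bigr => S _.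
  by rewrite coefZ coefXn.
rewrite exchange_big; apply: eq_bigr => S _.
have ltS : (#|S| < n.+1)%N by rewrite ltnS -[X in (_ <= X)%N](card_ord n) max_card.
rewrite (bigD1 (Ordinal ltS)) //= eqxx mulr1 big1 ?addr0 // => k kS.
have [kE|] := eqVneq (k : nat) #|S|; last by rewrite !mulr0.
by case/eqP: kS; apply: val_inj.
Qed.

Lemma polyfun_kraw b r z : (forall k, (r < k)%N -> b k = 0) ->
  polyfun ((q - 1) * r) (fun x => kraw b x z).
Proof.
move=> br; apply: polyfun_sum => S _.
have [Sr|rS] := leqP #|S| r; last first.
  by apply: polyfun_ext (polyfun_cst _ _ _ 0) => x; rewrite br // mul0r.
apply: polyfunZ; apply: (@polyfunW _ _ _ (\sum_(i in S) (q - 1))).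
  by rewrite sum_nat_const mulnC leq_mul2l Sr orbT.
apply: polyfun_prod => i _; apply: polyfunD; last exact: polyfun_cst.
by apply: polyfunZ; exact: polyfun_indic.
Qed.


Section Window.

Variables (r M : nat).
Hypotheses (M_gt0 : (0 < M)%N) (leMr : (M <= r.+1)%N) (lern : (r <= n)%N)
  (n_gt0 : (0 < n)%N).

Let w := (r.+1 - M)%N.
(** The squared norm of the k-th Krawtchouk polynomial. Dividing by its root in [b] gives weight 1
    to each normalized polynomial of degree w, ..., r; these are M in number. *)
Let N (k : nat) : R := 'C(n, k)%:R * (q%:R - 1) ^+ k.
Let win (k : nat) := (w <= k <= r)%N.
Let b (k : nat) : R := (win k)%:R / Num.sqrt (N k).

Lemma q1_ge1 : 1 <= q%:R - 1 :> R.
Proof. by rewrite lerBrDr -(natrD _ 1 1) ler_nat. Qed.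

Lemma N_gt0 k : (k <= n)%N -> 0 < N k.
Proof.
move=> kn; rewrite mulr_gt0 ?ltr0n ?bin_gt0 // exprn_gt0 //.
exact: lt_le_trans q1_ge1.
Qed.

Lemma b_ge0 k : 0 <= b k.
Proof. by rewrite divr_ge0 ?sqrtr_ge0. Qed.

Lemma sum_interval (lo hi c : nat) : (hi <= c)%N ->
  \sum_(k < c) (lo <= k < hi)%:R = (hi - lo)%:R :> R.
Proof.
move=> hic; rewrite -natr_sum; congr _%:R.
have -> : (hi - lo = minn hi c - lo)%N by rewrite (minn_idPl hic).
elim: c {hic} => [|c IHc]; first by rewrite big_ord0 minn0 sub0n.
by rewrite big_ord_recr /= IHc; lia.
Qed.

Lemma winW k : win k -> (k <= n)%N.
Proof. by case/andP=> _ kr; apply: leq_trans lern. Qed.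

Lemma intQ_window2 x : intQ (fun y => kraw b x y ^+ 2) = M%:R.
Proof.
rewrite intQ_kraw2 // (sumr_by_card (fun k => b k ^+ 2 * (q%:R - 1) ^+ k)).
have -> : M%:R = \sum_(k < n.+1) (w <= k < r.+1)%:R :> R.
  by rewrite sum_interval // /w subKn.
apply: eq_bigr => k _; rewrite ltnS /b -/(win k).
have [/winW/N_gt0 Nk|_] := boolP (win k); last by rewrite mul0r expr0n !mul0r.
rewrite mul1r exprVn sqr_sqrtr ?ltW // -mulrA [_ ^+ k * _]mulrC.
by rewrite -/(N k) mulVf // gt_eqF.
Qed.

(** A lower bound, uniform for w < k <= r, of k (n - k + 1) (q - 1), the squared coefficient that
    couples the normalized polynomials of degrees k - 1 and k. *)
Let Z : R := w%:R * (n - r)%:R * (q%:R - 1).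

Lemma window_term k : (k <= n)%N ->
  (w <= k < r.+1)%:R * (w%:R * (q%:R - 2)) +
    (w.+1 <= k < r.+1)%:R * (2 * Num.sqrt Z) <=
  k%:R * ((q%:R - 1) ^+ k * (b k * ((q%:R - 2) * b k + 2 * b k.-1))) *
    'C(n, k)%:R.
Proof.
move=> kn; have Nk := N_gt0 kn.
have q2 : 0 <= q%:R - 2 :> R by rewrite subr_ge0 ler_nat.
have -> : k%:R * ((q%:R - 1) ^+ k * (b k * ((q%:R - 2) * b k + 2 * b k.-1))) *
    'C(n, k)%:R = k%:R * (q%:R - 2) * (N k * b k ^+ 2) +
                  2 * (k%:R * (N k * (b k * b k.-1))).
  by rewrite /N; ring.
apply: lerD; rewrite ltnS -?/(win k).
  rewrite /b; have [wink|_] := boolP (win k); last first.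
    by rewrite !mul0r expr0n !mulr0.
  have [wk _] := andP wink.
  rewrite !mul1r exprVn sqr_sqrtr ?(ltW Nk) // mulfV ?gt_eqF // mulr1.
  by rewrite ler_wpM2r // ler_nat.
(* The coupling needs both k - 1 and k in the window, hence the strict bound and only M - 1 such
   terms in the end. *)
have [/andP[wk kr]|_] := boolP (w < k <= r)%N; last first.
  by rewrite mul0r !(ltW Nk, b_ge0, mulr_ge0).
rewrite mul1r ler_wpM2l //.
have k0 : (0 < k)%N by apply: leq_ltn_trans wk.
have Nk1 : 0 < N k.-1 by apply: N_gt0; apply: leq_trans (leq_pred k) kn.
have winE : win k && win k.-1.
  by rewrite /win kr (ltnW wk) -ltnS prednK // wk /= (leq_trans (leq_pred k)).
have [wink wink1] := andP winE.
rewrite /b wink wink1 !mul1r.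
set v := k%:R * _; have v0 : 0 <= v.
  by rewrite !(ltW Nk, invr_ge0, sqrtr_ge0, mulr_ge0).
rewrite -(ger0_norm v0) -sqrtr_sqr ler_wsqrtr //.
have -> : v ^+ 2 = k%:R ^+ 2 * N k / N k.-1.
  rewrite /v; move: (N k) (N k.-1) Nk Nk1 => p p1 p_gt0 p1_gt0.
  rewrite !exprMn !exprVn !sqr_sqrtr ?(ltW p_gt0) ?(ltW p1_gt0) //; field.
  by rewrite !gt_eqF.
have NE : k%:R * N k = (n - k.-1)%:R * (q%:R - 1) * N k.-1.
  rewrite /N -[in _ ^+ k](prednK k0) exprS.
  have := mul_bin_left n k.-1; rewrite prednK // => /(congr1 (fun a => a%:R : R)).
  rewrite !natrM => E. by rewrite [LHS]mulrA E; ring.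
rewrite expr2 -[_ * _ * N k]mulrA NE [k%:R * (_ * _)]mulrA mulfK ?gt_eqF //.
rewrite mulrA /Z; apply: ler_wpM2r; first exact: le_trans q1_ge1.
by rewrite -!natrM ler_nat leq_mul // ?(ltnW wk) //; lia.
Qed.

Lemma intQ_window_letters x :
  M%:R * (w%:R * (q%:R - 2)) + 2 * (M%:R - 1) * Num.sqrt Z <=
  intQ (fun y => \sum_l letter R x y l * kraw b x y ^+ 2).
Proof.
rewrite intQ_sum.
apply: le_trans (ler_sum _ (fun l _ => intQ_letter_kraw2 q_gt1 x l b_ge0)).
rewrite (exchange_big_dep xpredT) //=.
have -> : \sum_(S : {set 'I_n}) \sum_(l in S) (q%:R - 1) ^+ #|S| *
    (b #|S| * ((q%:R - 2) * b #|S| + 2 * b #|S|.-1)) =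
  \sum_(S : {set 'I_n}) #|S|%:R * ((q%:R - 1) ^+ #|S| *
    (b #|S| * ((q%:R - 2) * b #|S| + 2 * b #|S|.-1))).
  by apply: eq_bigr => S _; rewrite sumr_const -[LHS]mulr_natl.
rewrite (sumr_by_card (fun k => k%:R * ((q%:R - 1) ^+ k *
    (b k * ((q%:R - 2) * b k + 2 * b k.-1))))).
apply: (@le_trans _ _ (\sum_(k < n.+1)
   ((w <= k < r.+1)%:R * (w%:R * (q%:R - 2)) +
    (w.+1 <= k < r.+1)%:R * (2 * Num.sqrt Z)))); last first.
  by apply: ler_sum => k _; apply: window_term; rewrite -ltnS.
rewrite big_split /= -!mulr_suml !sum_interval // subKn //.
have -> : (r.+1 - w.+1 = M - 1)%N by rewrite /w; lia.
by rewrite lerD2l natrB // mulrCA mulrA.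
Qed.

(** A bound on the mean of the relative distance under the window kernel. For fixed M, as n grows
    and r / n tends to t > 0, only the factor 1 - 1/M separates its limit from [phi]. *)
Definition psi (r M : nat) : R :=
  (q%:R - 1) / q%:R - ((q%:R - 2) / q%:R * ((r.+1 - M)%:R / n%:R) +
    (1 - M%:R^-1) * (2 / q%:R *
      Num.sqrt ((q%:R - 1) * ((r.+1 - M)%:R / n%:R) * (1 - r%:R / n%:R)))).

Lemma sum_letters x y : \sum_l letter R x y l = q%:R * #|agree x y|%:R - n%:R.
Proof.
rewrite sumrB -mulr_sumr sumr_const card_ord; congr (_ * _ - _).
rewrite -natr_sum -sum1_card [in RHS]big_mkcond; congr _%:R.
by apply: eq_bigr => i _; rewrite inE; case: (x i == y i).
Qed.

Lemma window_kernel : exists kappa : nat -> R,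
  [/\ forall m, 0 <= kappa m,
      forall z, exists2 h : cube -> R, polyfun ((q - 1) * r) h &
        forall x, kappa #|agree x z| = h x ^+ 2,
      forall x : cube, intQ (fun y => kappa #|agree x y|) = 1 &
      forall x : cube, intQ (fun y => kappa #|agree x y| * (n - #|agree x y|)%:R)
        <= n%:R * psi r M].
Proof.
have [u uE] := kraw_agree b.
have M0 : 0 < M%:R :> R by rewrite ltr0n.
have n0 : 0 < n%:R :> R by rewrite ltr0n.
have q0 : 0 < q%:R :> R by rewrite ltr0n ltnW.
exists (fun m => M%:R^-1 * u m ^+ 2); split.
- by move=> m; rewrite mulr_ge0 ?invr_ge0 ?sqr_ge0.
- move=> z; exists (fun x => Num.sqrt M%:R^-1 * kraw b x z).
    apply: polyfunZ; apply: polyfun_kraw => k rk.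
    by rewrite /b /win leqNgt (leqNgt k) rk andbF mul0r.
  by move=> x; rewrite uE exprMn sqr_sqrtr // invr_ge0.
- move=> x; rewrite intQZ.
  have -> : (fun y => u #|agree x y| ^+ 2) = (fun y => kraw b x y ^+ 2).
    by apply/funext => y; rewrite uE.
  by rewrite intQ_window2 mulVf ?gt_eqF.
move=> x.
(* The distance is affine in the sum of the letters, so a lower bound for the latter bounds the mean
   distance above. *)
have dE y : (n - #|agree x y|)%:R =
    q%:R^-1 * (n%:R * (q%:R - 1) - \sum_l letter R x y l) :> R.
  rewrite sum_letters natrB; last by rewrite -[X in (_ <= X)%N](card_ord n) max_card.
  by field; rewrite gt_eqF.
have -> : intQ (fun y => M%:R^-1 * u #|agree x y| ^+ 2 * (n - #|agree x y|)%:R) =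
   n%:R * (q%:R - 1) / q%:R -
   (q%:R * M%:R)^-1 * intQ (fun y => \sum_l letter R x y l * kraw b x y ^+ 2).
  (* The two terms are packed as a sum over ['I_2] so that [intQ_sum] applies. *)
  have -> : (fun y => M%:R^-1 * u #|agree x y| ^+ 2 * (n - #|agree x y|)%:R) =
      (fun y => \sum_(i < 2) (if i == 0 then (q%:R * M%:R)^-1 * (n%:R * (q%:R - 1))
         * kraw b x y ^+ 2
        else - (q%:R * M%:R)^-1 * \sum_l letter R x y l * kraw b x y ^+ 2)).
    apply/funext => y; rewrite big_ord_recl big_ord1 /= -uE dE -mulr_suml.
    by field; rewrite !gt_eqF.
  rewrite intQ_sum big_ord_recl big_ord1 /= !intQZ intQ_window2.
  by field; rewrite !gt_eqF.
have main := intQ_window_letters x.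
have qM : 0 < (q%:R * M%:R)^-1 :> R by rewrite invr_gt0 mulr_gt0.
move: main; rewrite -(ler_pM2l qM) -lerN2 -(lerD2l (n%:R * (q%:R - 1) / q%:R)).
move=> main; apply: le_trans main _.
have -> : Num.sqrt Z = n%:R *
    Num.sqrt ((q%:R - 1) * ((r.+1 - M)%:R / n%:R) * (1 - r%:R / n%:R)).
  rewrite -{1}(ger0_norm (ltW n0)) -sqrtr_sqr -sqrtrM ?sqr_ge0 //.
  by congr Num.sqrt; rewrite /Z (natrB _ lern) /w; field; rewrite gt_eqF.
rewrite /psi -/w; set s := Num.sqrt _.
rewrite le_eqVlt; apply/orP; left; apply/eqP; field.
by rewrite !gt_eqF.
Qed.

End Window.
End WindowKernel.

(** * Error bounds for fixed n and r *)

Section ErrorBounds.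

Variables (R : realType) (q d n r M : nat).
Hypothesis q_gt1 : (1 < q)%N.
Notation cube := (qcube q n).
Implicit Types (x y z : cube) (f : rpoly R n).

(** The successor keeps D positive when d = 0, as the interpolation lemmas require. *)
Let D := ((q - 1) * d).+1.

(** The constant of [grid_modulus] for this D and B = 1. *)
Definition modulus_cst (q d : nat) : R :=
  2 * ((q - 1) * d).+2%:R * (2 * ((q - 1) * d).+1%:R) ^+ ((q - 1) * d).+1.

Lemma modulus_cst_ge0 : 0 <= modulus_cst q d.
Proof. by rewrite /modulus_cst !mulr_ge0 ?exprn_ge0 ?mulr_ge0. Qed.

Hypotheses (n_gt0 : (0 < n)%N) (M_gt0 : (0 < M)%N) (leMr : (M <= r.+1)%N)
  (lern : (r <= n)%N).

Lemma fminQ_attained f : exists x0 : cube,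
  fminQ q f = (evalQ f x0)%:E /\ forall x : cube, evalQ f x0 <= evalQ f x.
Proof.
pose c0 : cube := [ffun=> Ordinal (ltnW q_gt1)].
have [x0 _ x0min] := @Order.TotalTheory.arg_minP _ R cube c0 xpredT (evalQ f) isT.
exists x0; split; last by move=> x; exact: x0min.
apply/eqP; rewrite eq_le; apply/andP; split; first exact: bigmin_le_cond.
by apply: le_bigmin; rewrite ?leey // => x _; rewrite lee_fin x0min.
Qed.

Lemma supnormQ_le f x : `|evalQ f x| <= supnormQ q f.
Proof. exact: le_bigmax. Qed.

Lemma agreeC x y : agree x y = agree y x.
Proof. by apply/finset.setP => i; rewrite !inE eq_sym. Qed.

Lemma polys_local f : polys_le ((q - 1) * d) f -> local_fun D (@evalQ R q n f).
Proof.
by move=> fd; apply: local_polyfun; exists f => //; apply: leq_trans fd _.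
Qed.

Lemma smoothing : (D <= n)%N -> exists kappa : nat -> R,
  [/\ forall z, exists2 h : cube -> R, polyfun ((q - 1) * r) h &
        forall x, kappa #|agree x z| = h x ^+ 2,
      forall x, intQ (fun y : cube => kappa #|agree x y|) = 1,
      forall F : cube -> R, local_fun D F ->
        local_fun D (fun x => intQ (fun y => kappa #|agree x y| * F y)) &
      forall F : cube -> R, local_fun D F -> (forall x, `|F x| <= 1) ->
        forall x, `|intQ (fun y => kappa #|agree x y| * F y) - F x|
          <= modulus_cst q d * psi R q n r M].
Proof.
move=> Dn.
have [kappa [k0 ksq k1 kd]] := @window_kernel R q n q_gt1 r M M_gt0 leMr lern n_gt0.
exists kappa; split=> //.
  move=> F LF; have := local_fun_agree_kernel q_gt1
    (fun m => #|{: cube}|%:R^-1 * kappa m) LF.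
  by congr local_fun; apply/funext => x; apply: eq_bigr => y _; rewrite mulrA.
move=> F LF F1 x.
have k0' m : 0 <= #|{: cube}|%:R^-1 * kappa m by rewrite mulr_ge0 ?invr_ge0.
have := agree_kernel_deviation q_gt1 x k0' _ LF F1.
move=> /(_ Dn); rewrite mulr1.
have -> : \sum_y #|{: cube}|%:R^-1 * kappa #|agree x y| = 1 by exact: k1.
have -> : \sum_y #|{: cube}|%:R^-1 * kappa #|agree x y| * F y =
    intQ (fun y => kappa #|agree x y| * F y).
  by apply: eq_bigr => y _; rewrite mulrA.
have -> : \sum_y #|{: cube}|%:R^-1 * kappa #|agree x y| * (n - #|agree x y|)%:R =
    intQ (fun y => kappa #|agree x y| * (n - #|agree x y|)%:R).
  by apply: eq_bigr => y _; rewrite mulrA.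
rewrite mul1r => /le_trans; apply.
rewrite -mulrA ler_wpM2l ?modulus_cst_ge0 //.
by rewrite ler_pdivrMl ?ltr0n.
Qed.

Lemma upper_error_le : (D <= n)%N ->
  (upper_error R q d ((q - 1) * r) n <= (modulus_cst q d * psi R q n r M)%:E)%E.
Proof.
move=> Dn; have [kappa [ksq k1 _ kdev]] := smoothing Dn.
apply: ge_ereal_sup => _ /= [f [fd f1] <-].
have [x0 [-> x0min]] := fminQ_attained f.
(* The density is the kernel centred at a minimizer; [ksq] makes it a square in the first argument,
   whence the symmetry [agreeC]. *)
have [h ph hE] := ksq x0.
have [s ssos sE] := sosfun_sq ler01 ph.
have skE x : evalQ s x = kappa #|agree x0 x|.
  by rewrite sE mul1r -hE agreeC.
rewrite leeBlDr //; apply: (@le_trans _ _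
    (intQ (fun x : cube => evalQ f x * evalQ s x))%:E).
  apply: ereal_inf_lbound; exists s => //; split=> //.
  by rewrite -(k1 x0); apply: eq_bigr => y _; rewrite skE.
rewrite -EFinD lee_fin -lerBlDr.
have -> : intQ (fun x : cube => evalQ f x * evalQ s x) =
    intQ (fun x : cube => kappa #|agree x0 x| * evalQ f x).
  by apply: eq_bigr => y _; rewrite skE [in LHS](mulrC (evalQ f y)).
apply: le_trans (ler_norm _) (kdev _ (polys_local fd) _ x0) => x.
by rewrite -f1 supnormQ_le.
Qed.

Lemma lower_error_le : (D <= r)%N ->
  (lower_error R q d ((q - 1) * r) n <=
   (D.+1%:R * (2 * D%:R * n%:R / r%:R) ^+ D *
     (modulus_cst q d * psi R q n r M))%:E)%E.
Proof.
move=> Dr; have [kappa [ksq k1 kloc kdev]] := smoothing (leq_trans Dr lern).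
set B := modulus_cst q d * _ in kdev *; set K := _ * _ ^+ D.
apply: ge_ereal_sup => _ /= [f [fd f1] <-].
have [x0 [-> x0min]] := fminQ_attained f.
have Lf := polys_local fd.
pose Kf x : R := intQ (fun y => kappa #|agree x y| * evalQ f y).
pose e x : R := -1 * Kf x + evalQ f x.
have Le : local_fun D e := LocalLin (-1) (kloc _ Lf) Lf.
have eB x : `|e x| <= B.
  rewrite /e mulN1r addrC distrC; apply: kdev => // y.
  by rewrite -f1 supnormQ_le.
have se : sosfun ((q - 1) * r) (fun x => e x + K * B).
  exact: (sosfun_shift (ltnW q_gt1) (Dr : (0 < D <= r)%N) lern Le eB).
have sK : sosfun ((q - 1) * r) (fun x => Kf x - evalQ f x0).
  (* The smoothing of f minus its minimum combines the squares [kappa #|agree x y|] with the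
     nonnegative coefficients f y - f x0. *)
  apply: (@sosfun_ext _ _ _ _ (fun x => \sum_y
    (#|{: cube}|%:R^-1 * (evalQ f y - evalQ f x0)) * kappa #|agree x y|)) => [x|].
    rewrite -[in RHS](mul1r (evalQ f x0)) -[in RHS](k1 x) /Kf /intQ mulr_suml -sumrB.
    by apply: eq_bigr => y _; ring.
  apply: sosfun_sum => y _; have [h ph hE] := ksq y.
  apply: (sosfun_ext _ (sosfun_sq _ ph)) => [x|].
    by rewrite hE.
  by rewrite mulr_ge0 ?invr_ge0 ?subr_ge0.
have [s ssos sE] := sosfunD se sK.
apply: (@le_trans _ _ ((evalQ f x0)%:E - (evalQ f x0 - K * B)%:E)%E); last first.
  by rewrite -EFinB lee_fin subKr.
rewrite leeD2l // leeN2; apply: ereal_sup_ubound.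
(* The minimum lowered by the shift is feasible. *)
exists (evalQ f x0 - K * B) => //; exists s => // x.
by rewrite sE /e; ring.
Qed.

End ErrorBounds.

(** Here f is a constant c, and f - c is the empty sum of squares. The case d = 0 is separate since
    the condition on [phi] then leaves t = 0 possible. *)
Lemma lower_error0 (R : realType) (q n r : nat) : (1 < q)%N ->
  (lower_error R q 0 r n <= 0)%E.
Proof.
move=> q_gt1; apply: ge_ereal_sup => _ /= [f [fd _] <-].
move: fd; rewrite /polys_le /= muln0 => /mpoly.msize1_polyC fE.
set c := mpoly.mcoeff _ f in fE.
have fc (x : qcube q n) : evalQ f x = c by rewrite fE; exact: mpoly.mevalC.
have [x0 [-> _]] := fminQ_attained q_gt1 f; rewrite fc.
apply: (@le_trans _ _ (c%:E - c%:E)%E); last by rewrite subee.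
rewrite leeD2l // leeN2; apply: ereal_sup_ubound.
exists c => //; exists 0.
  by exists [::]; split => //; rewrite big_nil.
by move=> x; rewrite fc subrr; apply/esym; exact: mpoly.meval0.
Qed.

(** * Asymptotics *)

Local Open Scope classical_set_scope.

(** The limit superior is an infimum, over the sets of the filter, of suprema; the set where the
    bound holds is one of them. *)
Lemma limn_esup_le_eps (R : realType) (u : nat -> \bar R) (a : R) :
  (forall e : R, 0 < e -> \forall j \near \oo, (u j <= (a + e)%:E)%E) ->
  (limn_esup u <= a%:E)%E.
Proof.
move=> ua; apply/lee_addgt0Pr => e e0; rewrite -EFinD.
apply: (@le_trans _ _ (ereal_sup (u @` [set j | (u j <= (a + e)%:E)%E]))).
  apply: ereal_inf_lbound; exists [set j | (u j <= (a + e)%:E)%E] => //.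
  exact: ua.
by apply: ge_ereal_sup => _ [j /= uj <-].
Qed.

(** * Bounds on [phi] and the limit of [psi] *)

Section PhiFacts.

Variables (R : realType) (q : nat).
Hypothesis q_gt2 : (2 < q)%N.
Implicit Types t : R.

Lemma q_ge3 : 3 <= q%:R :> R.
Proof. by rewrite ler_nat. Qed.

(** Up to the factor 1/q, [phi] is the square of a difference of square roots. *)
Lemma phi_ge0 t : 0 <= t <= (q%:R - 1) / q%:R -> 0 <= phi q t.
Proof.
have q3 := q_ge3; have q0 : 0 < q%:R :> R by lra.
move=> /andP[t0]; rewrite ler_pdivlMr // => tq.
have t1 : 0 <= 1 - t by nra.
have -> : phi q t =
    (Num.sqrt ((q%:R - 1) * (1 - t)) - Num.sqrt t) ^+ 2 / q%:R.
  rewrite /phi sqrrB !sqr_sqrtr ?mulr_ge0 //; last by lra.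
  rewrite -sqrtrM ?mulr_ge0 //; last by lra.
  have -> : (q%:R - 1) * (1 - t) * t = (q%:R - 1) * t * (1 - t) by ring.
  by field; rewrite gt_eqF.
by rewrite divr_ge0 ?sqr_ge0 // ltW.
Qed.

Lemma phi_le_quarter t : 0 <= t <= (q%:R - 1) / q%:R -> phi q t <= 1 / 4 ->
  1 / 25 <= t.
Proof.
have q3 := q_ge3; have q0 : 0 < q%:R :> R by lra.
move=> /andP[t0]; rewrite ler_pdivlMr // => tq.
rewrite /phi; set s := Num.sqrt _ => phi4; rewrite leNgt; apply/negP => t25.
(* For t < 1/25 the radicand is at most (q - 1)/25, hence at most (q/10)^2 because 4 (q - 1) <=
   q^2. *)
have s_le : s <= q%:R / 10.
  have q10 : 0 <= q%:R / 10 :> R by lra.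
  rewrite -(ger0_norm q10) -sqrtr_sqr ler_wsqrtr //.
  have tt : t * (1 - t) <= 1 / 25 by nra.
  have : (q%:R - 1) * (t * (1 - t)) <= (q%:R - 1) * (1 / 25).
    by rewrite ler_wpM2l //; lra.
  by nra.
have : q%:R * ((q%:R - 1) / q%:R - ((q%:R - 2) / q%:R * t + 2 / q%:R * s)) <=
    q%:R * (1 / 4) by rewrite ler_wpM2l // ltW.
have -> : q%:R * ((q%:R - 1) / q%:R - ((q%:R - 2) / q%:R * t + 2 / q%:R * s)) =
  q%:R - 1 - ((q%:R - 2) * t + 2 * s) by field; rewrite gt_eqF.
by nra.
Qed.

Variables (t : R) (n_ r_ : nat -> nat).
Hypotheses (t_lt1 : t < 1) (n_gt0 : forall j, (0 < n_ j)%N)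
  (n_oo : n_ @ \oo --> \oo) (r_t : (r_ j)%:R / (n_ j)%:R @[j --> \oo] --> t).

Lemma near_geq N : \forall j \near \oo, (N <= n_ j)%N.
Proof. by move: N; apply/cvgnyPge. Qed.

Lemma near_leq_rn : \forall j \near \oo, (r_ j <= n_ j)%N.
Proof.
have : \forall j \near \oo, (r_ j)%:R / (n_ j)%:R < 1 :> R.
  exact: cvgr_lt r_t _ t_lt1.
apply: filterS => j; rewrite ltr_pdivrMr ?ltr0n // mul1r ltr_nat.
exact: ltnW.
Qed.

Lemma near_leq_ratio (c : R) : c < t ->
  \forall j \near \oo, c * (n_ j)%:R <= (r_ j)%:R.
Proof.
move=> ct.
have : \forall j \near \oo, c < (r_ j)%:R / (n_ j)%:R.
  exact: cvgr_gt r_t _ ct.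
by apply: filterS => j; rewrite ltr_pdivlMr ?ltr0n //; exact: ltW.
Qed.

Lemma near_geq_r N : 0 < t -> \forall j \near \oo, (N <= r_ j)%N.
Proof.
move=> t0; have t2 : t / 2 < t by lra.
have [m mN] : exists m : nat, 2 * N%:R / t <= m%:R.
  exists (Num.bound (2 * N%:R / t)).
  by rewrite ltW // archi_boundP // divr_ge0 // (ltW t0).
near=> j; rewrite -(ler_nat R).
have le1 : t / 2 * (n_ j)%:R <= (r_ j)%:R.
  by near: j; exact: near_leq_ratio.
have : m%:R <= (n_ j)%:R :> R by rewrite ler_nat; near: j; exact: near_geq.
move=> /(le_trans mN); rewrite ler_pdivrMr // => le2.
by apply: le_trans le1; lra.
Unshelve. all: by end_near. Qed.

Lemma near_psi (e : R) : 0 <= t -> 0 < e -> exists2 M, (0 < M)%N &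
  \forall j \near \oo, (M <= (r_ j).+1)%N /\
    psi R q (n_ j) (r_ j) M <= phi q t + e.
Proof.
move=> t_ge0 e0; have q3 := q_ge3; have q0 : 0 < q%:R :> R by lra.
have [tz|tn0] := eqVneq t 0.
  (* At t = 0 the [r_ j] may stay bounded. The window M = 1 always fits, and [psi] is then at most
     (q - 1)/q, the value of [phi] at 0. *)
  exists 1%N => //; near=> j; split=> //.
  rewrite /psi /phi tz invr1 subrr mul0r addr0 !mulr0 mul0r sqrtr0 mulr0.
  rewrite addr0 subr0 lerBlDr -addrA lerDl addr_ge0 ?(ltW e0) //.
  by rewrite !mulr_ge0 // ?invr_ge0 ?ltW //; lra.
have t_gt0 : 0 < t by rewrite lt0r tn0.
set sq := 2 / q%:R * Num.sqrt ((q%:R - 1) * t * (1 - t)).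
have sq0 : 0 <= sq by rewrite mulr_ge0 ?sqrtr_ge0 // divr_ge0 // ltW.
(* M is fixed before j, large enough that the loss sq / M is below e. *)
pose M := (Num.bound (sq / e)).+1; exists M => //.
have M_gt : sq / e < M%:R.
  by apply: lt_trans (archi_boundP _) _; rewrite ?ltr_nat // divr_ge0 // ltW.
have M0 : 0 < M%:R :> R by rewrite ltr0n.
have lim_psi : psi R q (n_ j) (r_ j) M @[j --> \oo] -->
    (q%:R - 1) / q%:R - ((q%:R - 2) / q%:R * t + (1 - M%:R^-1) * sq).
  have lim_w : ((r_ j).+1 - M)%:R / (n_ j)%:R @[j --> \oo] --> t.
    have inv_n : (n_ j)%:R^-1 @[j --> \oo] --> (0 : R).
      apply/gtr0_cvgV0; last by apply/cvgrnyP.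
      by apply: nearW => j; rewrite ltr0n.
    have : ((r_ j)%:R / (n_ j)%:R + (1 - M%:R) * (n_ j)%:R^-1) @[j --> \oo] --> t.
      rewrite -[X in _ --> X]addr0 -[X in _ --> _ + X](mulr0 (1 - M%:R)).
      by apply: cvgD => //; apply: cvgM inv_n; exact: cvg_cst.
    apply: cvg_trans; apply: near_eq_cvg.
    near=> j; have Mr : (M <= (r_ j).+1)%N.
      by apply: leqW; near: j; exact: near_geq_r.
    by rewrite natrB // -natr1; ring.
  rewrite /psi; apply: cvgB; first exact: cvg_cst.
  apply: cvgD; first by apply: cvgM lim_w; exact: cvg_cst.
  apply: cvgM; first exact: cvg_cst.
  apply: cvgM; first exact: cvg_cst.
  apply: continuous_cvg; first exact: sqrt_continuous.
  apply: cvgM; first by apply: cvgM lim_w; exact: cvg_cst.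
  by apply: cvgB r_t; exact: cvg_cst.
have lim_lt : (q%:R - 1) / q%:R - ((q%:R - 2) / q%:R * t + (1 - M%:R^-1) * sq) <
    phi q t + e.
  rewrite /phi -/sq; have : M%:R^-1 * sq < e.
    by rewrite mulrC ltr_pdivrMr // mulrC -ltr_pdivrMr.
  by lra.
near=> j; split; first by apply: leqW; near: j; exact: near_geq_r.
by apply: ltW; near: j; exact: cvgr_lt lim_psi _ lim_lt.
Unshelve. all: by end_near. Qed.

End PhiFacts.

Theorem theorem35 (R : realType) (q : nat) (hq : (2 < q)%N) (d : nat) :
  exists C : R, 0 < C /\
    forall (t : R), 0 <= t <= (q%:R - 1) / q%:R ->
    forall (n_ r_ : nat -> nat),
      (forall j, (d <= n_ j)%N) ->
      (forall j, (1 <= n_ j)%N) ->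
      n_ @ \oo --> \oo ->
      (r_ j)%:R / (n_ j)%:R @[j --> \oo] --> t ->
      (limn_esup (fun j => upper_error R q d ((q - 1) * r_ j)%N (n_ j))
         <= (C * phi q t)%:E)%E /\
      (d%:R * (d%:R + 1) * phi q t <= 1 / 2 ->
       (limn_esup (fun j => lower_error R q d ((q - 1) * r_ j)%N (n_ j))
         <= (2 * C * phi q t)%:E)%E).
Proof.
pose D := ((q - 1) * d).+1.
pose C1 : R := modulus_cst R q d.
(* The bound of [lower_error_le] once r / n >= 1/50, half of the lower bound 1/25 obtained for t. *)
pose K : R := D.+1%:R * (2 * D%:R * 50) ^+ D.
have C1_ge0 : 0 <= C1 by exact: modulus_cst_ge0.
have K_ge0 : 0 <= K by rewrite mulr_ge0 // exprn_ge0 // !mulr_ge0.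
pose C := C1 * (K + 1) + 1.
have C_gt0 : 0 < C by rewrite ltr_wpDl // mulr_ge0 // addr_ge0.
have C_C1 : C1 <= C by rewrite /C; nra.
have C_KC1 : K * C1 <= C by rewrite /C; nra.
exists C; split=> // t t01 n_ r_ _ n1 n_oo r_t.
have q1 : (1 < q)%N by exact: ltnW.
have q3 := q_ge3 R hq; have q0 : 0 < q%:R :> R by lra.
have phi0 := phi_ge0 hq t01.
have [t0 tq] := andP t01.
have t1 : t < 1 by rewrite (le_lt_trans tq) // ltr_pdivrMr //; lra.
have split_eps (e : R) : 0 < e -> C * (phi q t + e / C) = C * phi q t + e.
  by move=> _; field; rewrite gt_eqF.
split.
  apply: limn_esup_le_eps => e e0.
  have eC : 0 < e / C by rewrite divr_gt0.
  have [M M0 nearM] := near_psi hq n1 n_oo r_t t0 eC.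
  near=> j.
  have [Mr psi_le] : (M <= (r_ j).+1)%N /\
      psi R q (n_ j) (r_ j) M <= phi q t + e / C by near: j.
  have rn : (r_ j <= n_ j)%N by near: j; exact: (near_leq_rn t1 n1 r_t).
  have Dn : (D <= n_ j)%N by near: j; exact: (near_geq n_oo).
  apply: le_trans (upper_error_le R q1 (n1 j) M0 Mr rn Dn) _.
  rewrite lee_fin -split_eps //.
  apply: (@le_trans _ _ (C1 * (phi q t + e / C))); first by rewrite ler_wpM2l.
  by rewrite ler_wpM2r // addr_ge0 // (ltW eC).
move=> dphi; have [d0|d_gt0] := posnP d.
  apply: limn_esup_le_eps => e e0; apply: nearW => j; rewrite d0.
  apply: le_trans (lower_error0 R _ _ q1) _.
  by rewrite lee_fin addr_ge0 ?(ltW e0) // mulr_ge0 // mulr_ge0 // (ltW C_gt0).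
(* For d >= 1 one has d (d + 1) >= 2, so the condition gives [phi q t] <= 1/4. *)
have t25 : 1 / 25 <= t.
  apply: (phi_le_quarter hq t01).
  have d1 : 1 <= d%:R :> R by rewrite ler1n.
  have : 2 * phi q t <= d%:R * (d%:R + 1) * phi q t by rewrite ler_wpM2r //; nra.
  by lra.
apply: limn_esup_le_eps => e e0.
have eC : 0 < e / C by rewrite divr_gt0.
have [M M0 nearM] := near_psi hq n1 n_oo r_t t0 eC.
near=> j.
have [Mr psi_le] : (M <= (r_ j).+1)%N /\
    psi R q (n_ j) (r_ j) M <= phi q t + e / C by near: j.
have rn : (r_ j <= n_ j)%N by near: j; exact: (near_leq_rn t1 n1 r_t).
have Dr : (D <= r_ j)%N.
  by near: j; apply: (near_geq_r n1 n_oo r_t); lra.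
have ratio : 1 / 50 * (n_ j)%:R <= (r_ j)%:R :> R.
  by near: j; apply: (near_leq_ratio n1 r_t); lra.
apply: le_trans (lower_error_le R q1 (n1 j) M0 Mr rn Dr) _.
have r0 : 0 < (r_ j)%:R :> R by rewrite ltr0n (leq_trans _ Dr).
rewrite lee_fin -/D -/C1.
have le_K : D.+1%:R * (2 * D%:R * (n_ j)%:R / (r_ j)%:R) ^+ D <= K.
  rewrite ler_wpM2l // ler_pXn2r ?nnegrE ?mulr_ge0 ?invr_ge0 //.
  by rewrite -mulrA ler_wpM2l ?mulr_ge0 // ler_pdivrMr //; lra.
apply: (@le_trans _ _ (C * (phi q t + e / C))); last first.
  rewrite split_eps // lerD2r -mulrA ler_peMl ?ler1n //.
  by rewrite mulr_ge0 // (ltW C_gt0).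
have phie : 0 <= phi q t + e / C by rewrite addr_ge0 // (ltW eC).
set k := _ * _ ^+ D in le_K *; have k0 : 0 <= k.
  by rewrite /k mulr_ge0 // exprn_ge0 // !mulr_ge0 // invr_ge0.
apply: (@le_trans _ _ (k * (C1 * (phi q t + e / C)))).
  by rewrite !ler_wpM2l.
rewrite mulrA ler_wpM2r // (le_trans _ C_KC1) // ler_wpM2r //.
Unshelve. all: by end_near. Qed.
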